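(* The limit space of the airplane replacement system is an airplane.
   Context: Replacement systems and limit spaces. A graph is a finite directed multigraph (loops allowed), each edge having an initial and a terminal vertex. A replacement system consists of a base graph and, for each color $c$ in a finite set, a replacement graph $R_c$ with two distinguished distinct vertices $\iota_c,\tau_c$, all graphs being edge-colored by the given colors. A $c$-colored edge $e$ of a graph is expanded by replacing $e$ by a copy of $R_c$, identifying the initial and terminal vertices of $e$ with $\iota_c$ and $\tau_c$. A graph expansion is a graph obtained from the base graph by finitely many expansions. Edges of graph expansions are named by finite words: edges of the base graph are one-letter words and, when an edge $f$ of color $c$ is expanded, the new edges are $fe$ for $e$ an edge of $R_c$ (with the color of $e$). The symbol space $\mathfrak{C}$ is the set of infinite words each of whose nonempty finite prefixes is an edge of some graph expansion, with the subspace topology from the product topology on infinite words in the finite alphabet of all edges of the base and replacement graphs. The gluing relation is $x_1x_2\cdots\sim y_1y_2\cdots$ if and only if, for all large enough $k$, the edges $x_1\cdots x_k$ and $y_1\cdots y_k$ are incident (share a vertex) in all graph expansions that feature them both. For the system considered here it is an equivalence relation, and the limit space is the quotient $\mathfrak{C}/\sim$. The airplane replacement system has two colors, blue and red. Its base graph has two vertices and a single blue edge from one to the other. The blue replacement graph has four vertices $\iota_b,p,q,\tau_b$ and four edges: blue $b_1$ from $p$ to $\iota_b$, red $b_2$ from $q$ to $p$, red $b_3$ from $p$ to $q$, blue $b_4$ from $q$ to $\tau_b$. The red replacement graph has four vertices $\iota_r,m,\tau_r,t$ and three edges: red $r_1$ from $\iota_r$ to $m$, red $r_2$ from $m$ to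 $\tau_r$, blue $r_3$ from $m$ to $t$. An airplane is a Peano continuum (compact, metrizable, connected, locally connected space) such that: (1) the set of all cut points that belong to circles is dense; (2) if two points belong to distinct circles, they lie in distinct connected components of the complement of some third circle; (3) any two distinct circles are disjoint; (4) every cut point has order $2$. Here a circle is a subset homeomorphic to $\mathbf{S}^1$, the order of a point is the number of connected components of its complement, and a cut point is a point of order at least $2$. *)

(* Defs.v *)
From Stdlib Require Import RelationClasses.
From HB Require Import structures.
From mathcomp Require Import all_boot all_order all_algebra.
From mathcomp Require Import all_classical all_reals all_analysis.

Set Implicit Arguments.
Unset Strict Implicit.
Unset Printing Implicit Defensive.

Import Order.TTheory GRing.Theory Num.Theory.
Import numFieldNormedType.Exports.

Local Open Scope classical_set_scope.

(** * Replacement systems *)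

Record cgraph (C : Type) := CGraph {
  vert : finType;
  edge : finType;
  src : edge -> vert;
  tgt : edge -> vert;
  ecol : edge -> C
}.

Record replacement_system := ReplacementSystem {
  color : finType;
  base : cgraph color;
  repl : color -> cgraph color;
  ini : forall c, vert (repl c);
  ter : forall c, vert (repl c);
  ini_neq_ter : forall c, ini c != ter c
}.

(* The alphabet: the disjoint union of the edge sets of all the graphs. *)
Definition letter (S : replacement_system) : finType :=
  (edge (base S) + {c : color S & edge (repl c)})%type.

(* A graph whose edges are labelled by finite words. *)
Record named_graph (S : replacement_system) := NamedGraph {
  ngraph :> cgraph (color S);
  name : edge ngraph -> seq (letter S)
}.
Arguments name {S n} e.

Definition base_graph (S : replacement_system) : named_graph S :=
  @NamedGraph S (base S) (fun e => [:: inl e]).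

Section Expand.
Context {S : replacement_system} (G : named_graph S) (e : edge G).

Let R : cgraph (color S) := repl (ecol e).
Let inner (v : vert R) : bool := (v != ini (ecol e)) && (v != ter (ecol e)).

Definition expand_vert : finType := (vert G + {v : vert R | inner v})%type.
Definition expand_edge : finType := ({f : edge G | f != e} + edge R)%type.

(* [insub v] is [None] exactly when [v] is one of the two distinguished
   vertices of the replacement graph, which are identified with the endpoints
   of [e]. *)
Definition expand_glue (v : vert R) : expand_vert :=
  match insub v with
  | Some w => inr w
  | None => inl (if v == ini (ecol e) then src e else tgt e)
  end.

Definition expand : named_graph S :=
  @NamedGraph S
    (@CGraph _ expand_vert expand_edge
       (fun x => match x with
                 | inl f => inl (src (val f))
                 | inr r => expand_glue (src r)
                 end)
       (fun x => match x with
                 | inl f => inl (tgt (val f))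
                 | inr r => expand_glue (tgt r)
                 end)
       (fun x => match x with
                 | inl f => ecol (val f)
                 | inr r => ecol r
                 end))
    (fun x => match x with
              | inl f => name (val f)
              | inr r => rcons (name e)
                           (inr (Tagged (fun c => edge (repl c)) r))
              end).
End Expand.

Inductive graph_expansion (S : replacement_system) : named_graph S -> Prop :=
| expansion_base : graph_expansion (base_graph S)
| expansion_step (G : named_graph S) (e : edge G) :
    graph_expansion G -> graph_expansion (expand e).

Definition incident (C : Type) (G : cgraph C) (e f : edge G) : bool :=
  [exists v : vert G, (v \in [:: src e; tgt e]) && (v \in [:: src f; tgt f])].

(** * The limit space *)

Definition iword (S : replacement_system) : topologicalType :=
  prod_topology (fun _ : nat => discrete_topology (letter S)).

Definition prefix_word (S : replacement_system) (x : iword S) (k : nat) :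
  seq (letter S) := mkseq x k.

Definition symbol_space (S : replacement_system) : set (iword S) :=
  [set x | forall k, (0 < k)%N ->
     exists2 G : named_graph S, graph_expansion G &
       exists e : edge G, name e = prefix_word x k].
Arguments symbol_space S : clear implicits.

Definition gluing (S : replacement_system) (x y : symbol_space S) : Prop :=
  exists N : nat, forall k, (N <= k)%N ->
    forall G : named_graph S, graph_expansion G ->
    forall e f : edge G,
      name e = prefix_word (set_val x) k -> name f = prefix_word (set_val y) k ->
      incident e f.

Section LimitSpace.
Context (S : replacement_system) (eqS : Equivalence (@gluing S)).

Definition gluing_rel : rel (symbol_space S) := fun x y => `[< gluing x y >].

Lemma gluing_rel_refl : reflexive gluing_rel.
Proof. by move=> x; apply/asboolP; case: eqS. Qed.

Lemma gluing_rel_sym : symmetric gluing_rel.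
Proof.
case: eqS => _ sym _ x y.
by apply/idP/idP => /asboolP xy; apply/asboolP; apply: sym.
Qed.

Lemma gluing_rel_trans : transitive gluing_rel.
Proof.
case: eqS => _ _ tr y x z /asboolP xy /asboolP yz.
by apply/asboolP; apply: tr xy yz.
Qed.

Definition gluing_equiv : equiv_rel (symbol_space S) :=
  EquivRel gluing_rel gluing_rel_refl gluing_rel_sym gluing_rel_trans.

Definition limit_space : topologicalType :=
  quotient_topology {eq_quot gluing_equiv}%qT.
End LimitSpace.

(* The gluing relation is an equivalence relation as soon as no edge of a
   replacement graph joins its two distinguished vertices. *)
Module GluingTheory.
Section GluingEquivalence.
Context (S : replacement_system).
Context (no_bridge : forall (c : color S) (r : edge (repl c)),
  ~~ ((ini c \in [:: src r; tgt r]) && (ter c \in [:: src r; tgt r]))).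

Definition word := seq (letter S).

(* Every vertex of a graph expansion is named, by a vertex of the base graph or
   by the expanded edge that created it together with a vertex of the
   replacement graph; [None] is only used for the empty word. *)
Definition vname :=
  option (vert (base S) + word * {c : color S & vert (repl c)})%type.

Definition fresh (u : word) (c : color S) (v : vert (repl c)) : vname :=
  Some (inr (u, Tagged (fun c => vert (repl c)) v)).

Definition resolve (u : word) (a b : vname) (c : color S) (v : vert (repl c)) :=
  if v == ini c then a else if v == ter c then b else fresh u v.

Fixpoint rends (w : word) : vname * vname :=
  match w with
  | [::] => (None, None)
  | inl e :: _ => (Some (inl (src e)), Some (inl (tgt e)))
  | inr r :: u =>
      let ab := rends u in
      (resolve (rev u) ab.1 ab.2 (src (tagged r)),
       resolve (rev u) ab.1 ab.2 (tgt (tagged r)))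
  end.

Definition vends (w : word) : seq vname :=
  [:: (rends (rev w)).1; (rends (rev w)).2].

Definition rlet (c : color S) (r : edge (repl c)) : letter S :=
  inr (Tagged (fun c => edge (repl c)) r).

Lemma vends_rcons u c (r : edge (repl c)) :
  vends (rcons u (rlet r)) =
  [:: resolve u (rends (rev u)).1 (rends (rev u)).2 (src r);
      resolve u (rends (rev u)).1 (rends (rev u)).2 (tgt r)].
Proof. by rewrite /vends rev_rcons /= revK. Qed.

Lemma vends_fresh u w t : Some (inr (w, t)) \in vends u ->
  prefix w u && (size w < size u)%N.
Proof.
elim/last_ind: u => [|u [e|[c r]] IH]; first by rewrite /vends /= !inE.
  by rewrite /vends rev_rcons /= !inE.
rewrite -[inr (existT _ c r)]/(rlet r); set P := (X in _ -> X).
have inu z : z \in vends u -> Some (inr (w, t)) = z -> P.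
  move=> zu zE; move: zu; rewrite -zE => /IH /andP[wu su].
  rewrite /P size_rcons (ltn_trans su) // andbT.
  by apply: prefix_trans wu _; exact: prefix_rcons.
have main (v : vert (repl c)) :
   Some (inr (w, t)) = resolve u (rends (rev u)).1 (rends (rev u)).2 v -> P.
  rewrite /resolve; case: ifP => _; first by apply: inu; rewrite !inE eqxx.
  case: ifP => _; first by apply: inu; rewrite !inE eqxx orbT.
  by case=> wu _; rewrite /P wu prefix_rcons size_rcons ltnSn.
by rewrite vends_rcons in_cons mem_seq1 => /orP[] /eqP; exact: main.
Qed.

(* An endpoint of a new edge is new or an endpoint of the expanded edge. *)
Lemma vends_step u c (r : edge (repl c)) z : z \in vends (rcons u (rlet r)) ->
  z \in vends u \/ exists v : vert (repl c), z = fresh u v.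
Proof.
have main (v : vert (repl c)) :
   z = resolve u (rends (rev u)).1 (rends (rev u)).2 v ->
   z \in vends u \/ exists v : vert (repl c), z = fresh u v.
  rewrite /resolve; case: ifP => _; first by move->; left; rewrite !inE eqxx.
  case: ifP => _; first by move->; left; rewrite !inE eqxx orbT.
  by move=> ->; right; exists v.
by rewrite vends_rcons in_cons mem_seq1 => /orP[] /eqP; exact: main.
Qed.

Lemma fresh_notin u c (v : vert (repl c)) : fresh u v \notin vends u.
Proof. by apply/negP => /vends_fresh /andP[_]; rewrite ltnn. Qed.

Lemma vends_step_uniq u c (r : edge (repl c)) y z :
  y \in vends (rcons u (rlet r)) -> y \in vends u ->
  z \in vends (rcons u (rlet r)) -> z \in vends u -> y = z.
Proof.
have main y' : y' \in vends (rcons u (rlet r)) -> y' \in vends u ->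
   (y' = (rends (rev u)).1 /\ ini c \in [:: src r; tgt r]) \/
   (y' = (rends (rev u)).2 /\ ter c \in [:: src r; tgt r]).
  have aux (v : vert (repl c)) : v \in [:: src r; tgt r] -> y' \in vends u ->
    y' = resolve u (rends (rev u)).1 (rends (rev u)).2 v ->
   (y' = (rends (rev u)).1 /\ ini c \in [:: src r; tgt r]) \/
   (y' = (rends (rev u)).2 /\ ter c \in [:: src r; tgt r]).
    move=> vr y'u; rewrite /resolve; case: ifP => [/eqP <-|_]; first by left.
    case: ifP => [/eqP <-|_]; first by right.
    by move=> y'E; move: y'u; rewrite y'E (negbTE (fresh_notin _ _)).
  rewrite vends_rcons inE => /orP[|].
    by move=> /eqP y'E y'u; apply: aux y'E => //; rewrite !inE eqxx.
  by rewrite inE => /eqP y'E y'u; apply: aux y'E => //; rewrite !inE eqxx orbT.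
move=> y1 y2 z1 z2; have := no_bridge r.
case: (main _ y1 y2) => -[-> iy]; case: (main _ z1 z2) => -[-> iz] //;
  by rewrite ?iy ?iz.
Qed.

Definition lcol (l : letter S) : color S :=
  match l with inl e => ecol e | inr r => ecol (tagged r) end.

Definition follows : rel (letter S) := fun l l' =>
  if l' is inr r then tag r == lcol l else false.

Definition wf_edge (G : named_graph S) (e : edge G) := exists b s,
  [/\ name e = inl b :: s, path follows (inl b) s
    & ecol e = lcol (last (inl b) s)].

Definition wf_graph (G : named_graph S) :=
  [/\ forall e : edge G, wf_edge e,
      forall e f : edge G, prefix (name e) (name f) -> e = f
    & exists phi : vert G -> vname, [/\ injective phi,
        forall e : edge G, vends (name e) = [:: phi (src e); phi (tgt e)]
      & forall (e : edge G) v w t, phi v = Some (inr (w, t)) -> ~~ prefix (name e) w]].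

Lemma wf_expansion (G : named_graph S) : graph_expansion G -> wf_graph G.
Proof.
elim=> {G} [|G e _ [wfG antiG [phi [phiI phiE phiF]]]].
  split=> //.
  - by move=> e; exists e, [::].
  - by move=> e f /= /andP[/eqP[->]].
  - by exists (fun v => Some (inl v)); split => // u v [].
split.
- move=> [f|r] /=; first by have [b [s ?]] := wfG (val f); exists b, s.
  have [b [s [es ps cs]]] := wfG e; exists b, (rcons s (rlet r)); split.
  + by rewrite /= es.
  + by rewrite rcons_path ps /= cs.
  + by rewrite last_rcons.
- move=> [f|r] [g|s] /=.
  + by move=> /antiG /val_inj ->.
  + move=> pf; have [pe|npe] := boolP (prefix (name (val f)) (name e)).
      by move/antiG: pe => fe; have := valP f; rewrite fe eqxx.
    have szf : (size (name (val f)) <= (size (name e)).+1)%N.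
      by rewrite -(size_rcons _ (rlet s)); exact: size_prefix.
    move: pf; rewrite prefixE -cats1 => /eqP pf.
    move: szf pf; rewrite leq_eqVlt => /orP[/eqP sz|].
      rewrite sz take_oversize ?size_cat ?addn1 // => ef.
      have : prefix (name e) (name (val f)) by rewrite -ef prefix_prefix.
      by move/antiG => fe; have := valP f; rewrite -fe eqxx.
    rewrite ltnS => sz; rewrite takel_cat // => /eqP.
    by rewrite -prefixE (negbTE npe).
  + move=> pr; have : prefix (name e) (name (val g)).
      by apply: prefix_trans pr; exact: prefix_rcons.
    by move/antiG => ge; have := valP g; rewrite -ge eqxx.
  + rewrite prefixE size_rcons -(size_rcons (name e) (rlet s)) take_size.
    move=> /eqP/(congr1 (last (rlet r))); rewrite !last_rcons => rs.
    suff -> : s = r by [].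
    have /eqP : Tagged (fun c => edge (repl c)) s =
      Tagged (fun c => edge (repl c)) r by case: rs.
    by rewrite eq_Tagged => /eqP.
pose psi (x : expand_vert e) : vname := match x with
  | inl v => phi v | inr v => fresh (name e) (val v) end.
have neq v (u : {v : vert (repl (ecol e)) |
    (v != ini (ecol e)) && (v != ter (ecol e))}) :
  phi v <> fresh (name e) (val u).
  by move=> /(phiF e); rewrite prefix_refl.
have psiG v : psi (expand_glue v) = resolve (name e) (phi (src e)) (phi (tgt e)) v.
  rewrite /expand_glue /resolve; case: insubP => [u|].
    by case/andP=> /negbTE -> /negbTE -> /= ->.
  by rewrite negb_and !negbK /=; case: ifP => //= _ ->.
exists psi; split.
- move=> [u|u] [v|v] /=.
  + by move/phiI ->.
  + by move/neq.
  + by move/esym/neq.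
  + by case=> /eqP; rewrite eq_Tagged => /eqP /val_inj ->.
- move=> [f|r] /=; first exact: phiE.
  rewrite vends_rcons !psiG; move: (phiE e); rewrite /vends.
  by case=> -> ->.
- move=> [f|r] [v|v] w t /=.
  + exact: phiF.
  + case=> <- _; apply/negP => /antiG fe.
    by have := valP f; rewrite /= fe eqxx.
  + move=> /(phiF e); apply: contra => pr.
    by apply: prefix_trans pr; exact: prefix_rcons.
  + case=> <- _; apply/negP => /size_prefix; rewrite size_rcons ltnn //.
Qed.


Lemma symbol_val (x : symbol_space S) : symbol_space S (set_val x).
Proof. exact: set_mem (valP x). Qed.

Lemma prefix_wordS (x : iword S) k :
  prefix_word x k.+1 = rcons (prefix_word x k) (x k).
Proof. exact: mkseqS. Qed.

Lemma symbol_step (x : iword S) k : symbol_space S x -> (0 < k)%N ->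
  exists b s, [/\ prefix_word x k = inl b :: s &
    exists r : edge (repl (lcol (last (inl b) s))), x k = rlet r].
Proof.
move=> sx k0; have [G /wf_expansion[wfG _ _] [e eE]] := sx k.+1 isT.
have [b [s [es ps cs]]] := wfG e.
move: eE; rewrite es prefix_wordS {cs es}.
have := size_mkseq x k; rewrite -/(prefix_word x k).
case/lastP: s ps => [|s l] ps sz eE.
  by move/(congr1 size): eE; rewrite size_rcons sz => -[kE]; rewrite -kE in k0.
move: eE; rewrite -rcons_cons => /rcons_inj[<- lE]; exists b, s; split=> //.
move: ps; rewrite rcons_path lE => /andP[_]; case: (x k) => [//|[c r]] /=.
by move=> /eqP cE; subst c; exists r.
Qed.

Lemma expand_prefix (x : iword S) (G : named_graph S) (e : edge G) k :
  symbol_space S x -> graph_expansion G -> (0 < k)%N ->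
  name e = prefix_word x k ->
  exists f : edge (expand e), name f = prefix_word x k.+1.
Proof.
move=> sx /wf_expansion[wfG _ _] k0 eE.
have [b [s [es ps cs]]] := wfG e.
have [b' [s' [es' xr]]] := symbol_step sx k0.
have [bE sE] : inl b = inl b' :> letter S /\ s = s'.
  by move: es'; rewrite -eE es => -[-> ->].
move: xr; rewrite -bE -sE -cs => -[r xr].
by exists (inr r); rewrite /= eE prefix_wordS xr.
Qed.

Lemma featured_prefix (x : iword S) (G : named_graph S) :
  symbol_space S x -> graph_expansion G ->
  exists k, (0 < k)%N /\ exists e : edge G, name e = prefix_word x k.
Proof.
move=> sx; elim=> {G} [|G e GE [k [k0 [f fE]]]].
  exists 1%N; split=> //.
  have [G /wf_expansion[wfG _ _] [e eE]] := sx 1%N isT.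
  have [b [s [es _ _]]] := wfG e; exists b.
  by by move: eE; rewrite es /prefix_word /mkseq /= => -[bx _]; congr [:: _].
have [fe|nfe] := eqVneq f e.
  exists k.+1; split=> //; apply: expand_prefix => //; by rewrite -fe.
by exists k; split=> //; exists (inl (Sub f nfe)).
Qed.

Lemma refine (x : iword S) (G : named_graph S) k :
  symbol_space S x -> graph_expansion G -> (0 < k)%N ->
  (forall e : edge G, size (name e) <= k)%N ->
  exists G' : named_graph S, [/\ graph_expansion G',
    forall e : edge G', (size (name e) <= k)%N,
    exists e : edge G', name e = prefix_word x k
    & forall f : edge G, size (name f) = k ->
        exists f' : edge G', name f' = name f].
Proof.
move=> sx GE k0 Gk; have [j [j0 [e eE]]] := featured_prefix sx GE.
have jk : (j <= k)%N by have := Gk e; rewrite eE size_mkseq.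
move: (k - j)%N (subnK jk) => m.
elim: m G GE Gk j j0 e eE {jk} => [|m IH] G GE Gk j j0 e eE jk.
  by exists G; split=> //; [exists e; rewrite eE -jk | move=> f _; exists f].
have [f fE] := expand_prefix sx GE j0 eE.
have Ek (h : edge (expand e)) : (size (name h) <= k)%N.
  case: h => [h|r]; first exact: Gk.
  by rewrite /= size_rcons eE size_mkseq -jk addSn ltnS leq_addl.
have jk' : (m + j.+1 = k)%N by rewrite -jk addSnnS.
have [G' [G'E G'k G'x G'f]] := IH _ (expansion_step e GE) Ek j.+1 isT f fE jk'.
exists G'; split=> // h hk.
have nhe : h != e.
  apply/eqP => he; move: hk; rewrite he eE size_mkseq -jk => /eqP.
  by rewrite -[X in X == _]add0n eqn_add2r.
by have [f' f'E] := G'f (inl (Sub h nhe)) hk; exists f'.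
Qed.

Lemma common_expansion (x y : iword S) k :
  symbol_space S x -> symbol_space S y -> (0 < k)%N ->
  exists2 G : named_graph S, graph_expansion G &
    exists e f : edge G, name e = prefix_word x k /\ name f = prefix_word y k.
Proof.
move=> sx sy k0.
have [//|G1 [G1E G1k [e eE] _]] := @refine x _ k sx (expansion_base S) k0.
have [G2 [G2E _ [f fE] G2f]] := refine sy G1E k0 G1k.
exists G2 => //; have [|e' e'E] := G2f e; first by rewrite eE size_mkseq.
by exists e', f; rewrite e'E.
Qed.

Definition touching (u w : word) := exists z, z \in vends u /\ z \in vends w.

Lemma incidentP (G : named_graph S) (e f : edge G) : graph_expansion G ->
  incident e f <-> touching (name e) (name f).
Proof.
move=> /wf_expansion[_ _ [phi [phiI phiE _]]].
have mapE (h : edge G) : vends (name h) = map phi [:: src h; tgt h].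
  by rewrite phiE.
split.
  move=> /existsP[v /andP[ve vf]]; exists (phi v).
  by rewrite !mapE !(mem_map phiI).
move=> [z []]; rewrite !mapE => /mapP[v ve ->]; rewrite (mem_map phiI) => vf.
by apply/existsP; exists v; rewrite ve.
Qed.

Lemma gluingP (x y : symbol_space S) : gluing x y <->
  exists N, forall k, (N <= k)%N ->
    touching (prefix_word (set_val x) k) (prefix_word (set_val y) k).
Proof.
split=> [[N Nxy]|[N Nxy]].
  exists (maxn N 1) => k; rewrite geq_max => /andP[Nk k0].
  have [G GE [e [f [eE fE]]]] :=
    common_expansion (symbol_val x) (symbol_val y) k0.
  rewrite -[X in touching X]eE -[X in touching _ X]fE; apply/incidentP => //.
  exact: (Nxy k).
exists N => k Nk G GE e f eE fE; apply/incidentP => //.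
by rewrite eE fE; exact: Nxy.
Qed.

Lemma touching_descend (x y : iword S) k z :
  symbol_space S x -> symbol_space S y -> (0 < k)%N ->
  prefix_word x k != prefix_word y k ->
  z \in vends (prefix_word x k.+1) -> z \in vends (prefix_word y k.+1) ->
  z \in vends (prefix_word x k) /\ z \in vends (prefix_word y k).
Proof.
move=> sx sy k0 xy.
have [? [? [_ [r xr]]]] := symbol_step sx k0.
have [? [? [_ [s ys]]]] := symbol_step sy k0.
rewrite !prefix_wordS xr ys => /vends_step zx /vends_step zy.
case: zx zy => [zx|[v zv]] [zy|[w zw]] //.
- by move: zx; rewrite zw => /vends_fresh; rewrite !size_mkseq ltnn andbF.
- by move: zy; rewrite zv => /vends_fresh; rewrite !size_mkseq ltnn andbF.
- by move: xy; rewrite zv in zw; case: zw => ->; rewrite eqxx.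
Qed.

Lemma gluing_vertex (x y : symbol_space S) : x <> y -> gluing x y ->
  exists z N, forall k, (N <= k)%N ->
    z \in vends (prefix_word (set_val x) k) /\
    z \in vends (prefix_word (set_val y) k).
Proof.
move=> nxy /gluingP[N Nxy].
have sx := symbol_val x; have sy := symbol_val y.
have [i xyi] : exists i, (set_val x : nat -> letter S) i <> set_val y i.
  apply: contrapT => /forallNP h; apply: nxy; apply: val_inj.
  by apply: funext => i; apply: contrapT; exact: h.
have neq k : (i < k)%N ->
    prefix_word (set_val x) k != prefix_word (set_val y) k.
  move=> ik; apply/eqP => /(congr1 (fun s => nth (set_val x i : letter S) s i)).
  by rewrite !nth_mkseq.
pose K := maxn N i.+1.
have desc k z : (K <= k)%N ->
  z \in vends (prefix_word (set_val x) k.+1) ->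
  z \in vends (prefix_word (set_val y) k.+1) ->
  z \in vends (prefix_word (set_val x) k) /\
  z \in vends (prefix_word (set_val y) k).
  rewrite geq_max => /andP[_ ik]; apply: touching_descend => //.
    exact: leq_trans ik.
  exact: neq.
have NK k : (K <= k)%N -> (N <= k)%N by rewrite geq_max => /andP[].
have [z [zx zy]] := Nxy K.+1 (leqW (NK _ (leqnn _))).
exists z, K.+1; elim=> // k IH; rewrite leq_eqVlt => /orP[/eqP[<-]//|].
rewrite ltnS => Kk; have [zkx zky] := IH Kk.
have [z' [z'x z'y]] := Nxy k.+1 (leqW (NK _ (ltnW Kk))).
have [z'kx z'ky] := desc _ _ (ltnW Kk) z'x z'y.
suff -> : z = z' by [].
case: k Kk zkx zky z'kx z'ky {IH z'x z'y} => // k Kk zkx zky z'kx z'ky.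
have [zk _] := desc _ _ Kk zkx zky; have [z'k _] := desc _ _ Kk z'kx z'ky.
have k0 : (0 < k)%N by apply: leq_trans (Kk : (K <= k)%N); rewrite leq_max orbT.
have [? [? [_ [r xr]]]] := symbol_step sx k0.
move: zkx z'kx; rewrite prefix_wordS xr => zkx z'kx.
exact: vends_step_uniq zkx zk z'kx z'k.
Qed.

Lemma gluing_equivalence : Equivalence (@gluing S).
Proof.
split.
- move=> x; apply/gluingP; exists 0%N => k _.
  by exists (rends (rev (prefix_word (set_val x) k))).1; rewrite /vends mem_head.
- move=> x y /gluingP[N Nxy]; apply/gluingP; exists N => k /Nxy[z [? ?]].
  by exists z.
move=> x y z xy yz.
have [->//|/eqP nxy] := eqVneq x y; have [<-//|/eqP nyz] := eqVneq y z.
have [a [N Na]] := gluing_vertex nxy xy; have [b [M Mb]] := gluing_vertex nyz yz.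
suff ab : a = b.
  apply/gluingP; exists (maxn N M) => k; rewrite geq_max => /andP[Nk Mk].
  by exists a; split; [case: (Na _ Nk)|rewrite ab; case: (Mb _ Mk)].
pose k := (maxn (maxn N M) 1)%N.
have k0 : (0 < k)%N by rewrite leq_max orbT.
have Nk : (N <= k)%N by rewrite !leq_max leqnn.
have Mk : (M <= k)%N by rewrite !leq_max leqnn orbT.
have [? [? [_ [r yr]]]] := symbol_step (symbol_val y) k0.
have [_ a1] := Na _ (leqW Nk); have [_ a0] := Na _ Nk.
have [b1 _] := Mb _ (leqW Mk); have [b0 _] := Mb _ Mk.
move: a1 b1; rewrite prefix_wordS yr => a1 b1.
exact: vends_step_uniq a1 a0 b1 b0.
Qed.

End GluingEquivalence.
End GluingTheory.

(** * Airplanes *)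

Definition homeomorphic (X Y : topologicalType) : Prop :=
  exists (f : X -> Y) (g : Y -> X),
    [/\ continuous f, continuous g, cancel f g & cancel g f].

Definition metrizable (R : realType) (T : topologicalType) : Prop :=
  exists M : metricType R, homeomorphic T M.

Definition locally_connected (T : topologicalType) : Prop :=
  forall (x : T) (U : set T), nbhs x U ->
    exists V : set T, [/\ open V, V x, connected V & V `<=` U].

Definition peano_continuum (R : realType) (T : topologicalType) : Prop :=
  [/\ compact [set: T], metrizable R T, connected [set: T]
    & locally_connected T].

Definition unit_circle (R : realType) : set (R * R) :=
  [set z | z.1 ^+ 2 + z.2 ^+ 2 = 1]%R.
Arguments unit_circle R : clear implicits.

Definition circle (R : realType) (T : topologicalType) (A : set T) : Prop :=
  homeomorphic (set_type A) (set_type (unit_circle R)).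

(* The order of [x] is the cardinality of this set. *)
Definition complement_components (T : topologicalType) (x : T) : set (set T) :=
  connected_component (~` [set x]) @` (~` [set x]).

Definition cut_point (T : topologicalType) (x : T) : Prop :=
  (`I_2 #<= complement_components x)%card.

Definition order_two (T : topologicalType) (x : T) : Prop :=
  (complement_components x #= `I_2)%card.

Record airplane (R : realType) (T : topologicalType) : Prop := Airplane {
  airplane_peano : peano_continuum R T;
  airplane_dense :
    dense [set x : T | cut_point x /\ exists2 A, circle R A & A x];
  airplane_separated : forall (A B : set T) (x y : T),
    circle R A -> circle R B -> A <> B -> A x -> B y ->
    exists D : set T,
      [/\ circle R D, D <> A, D <> B, (~` D) x /\ (~` D) y
        & connected_component (~` D) x <> connected_component (~` D) y];
  airplane_disjoint : forall A B : set T,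
    circle R A -> circle R B -> A <> B -> A `&` B = set0;
  airplane_order : forall x : T, cut_point x -> order_two x
}.

(** * The airplane replacement system *)

Definition blue : bool := true.
Definition red : bool := false.

Definition airplane_base : cgraph bool :=
  @CGraph bool 'I_2 'I_1
    (fun _ => @Ordinal 2 0 isT) (fun _ => @Ordinal 2 1 isT) (fun _ => blue).

Section BlueGraph.
Let vini : 'I_4 := @Ordinal 4 0 isT.
Let p : 'I_4 := @Ordinal 4 1 isT.
Let q : 'I_4 := @Ordinal 4 2 isT.
Let vter : 'I_4 := @Ordinal 4 3 isT.

Definition blue_graph : cgraph bool :=
  @CGraph bool 'I_4 'I_4
    (tnth [tuple p; q; p; q])
    (tnth [tuple vini; p; q; vter])
    (tnth [tuple blue; red; red; blue]).
End BlueGraph.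

Section RedGraph.
Let vini : 'I_4 := @Ordinal 4 0 isT.
Let m : 'I_4 := @Ordinal 4 1 isT.
Let vter : 'I_4 := @Ordinal 4 2 isT.
Let t : 'I_4 := @Ordinal 4 3 isT.

Definition red_graph : cgraph bool :=
  @CGraph bool 'I_4 'I_3
    (tnth [tuple vini; m; m])
    (tnth [tuple m; vter; t])
    (tnth [tuple red; red; blue]).
End RedGraph.

Definition airplane_repl (c : bool) : cgraph bool :=
  match c with true => blue_graph | false => red_graph end.

Definition airplane_ini (c : bool) : vert (airplane_repl c) :=
  match c with
  | true => @Ordinal 4 0 isT : vert blue_graph
  | false => @Ordinal 4 0 isT : vert red_graph
  end.

Definition airplane_ter (c : bool) : vert (airplane_repl c) :=
  match c with
  | true => @Ordinal 4 3 isT : vert blue_graph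
  | false => @Ordinal 4 2 isT : vert red_graph
  end.

Lemma airplane_ini_neq_ter c : airplane_ini c != airplane_ter c.
Proof. by case: c. Qed.

Definition airplane_system : replacement_system :=
  @ReplacementSystem bool airplane_base airplane_repl airplane_ini airplane_ter
    airplane_ini_neq_ter.

Lemma airplane_gluing : Equivalence (@gluing airplane_system).
Proof.
apply: GluingTheory.gluing_equivalence => c r.
by case: c r => [] [[|[|[|[|//]]]] ?].
Qed.

Definition airplane_limit_space : topologicalType :=
  limit_space airplane_gluing.

(* Main.v *)
Require Import Defs.
From HB Require Import structures.
From mathcomp Require Import all_boot all_order all_algebra.
From mathcomp Require Import all_classical all_reals all_analysis.
From mathcomp Require Import zify ring lra.

Set Implicit Arguments.
Unset Strict Implicit.
Unset Printing Implicit Defensive.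

Import Order.TTheory GRing.Theory Num.Theory.
Import numFieldNormedType.Exports.

(** The limit space is a circle to which a wing is attached at each of countably
    many sites, and each wing is again a copy of the whole space. Indeed the blue
    replacement graph consists of a circle, the edges [b2] and [b3], with two
    blue edges at the points [p] and [q]; expanding the red edges for ever turns
    them into half circles with a blue edge at every dyadic point. The cell of
    each of these blue edges is a copy of the space, glued to the circle by its
    initial end, which is the [bottom] of the copy. The bottom of the space itself
    is the tip of the wing at [p], and its other end, the [top], is the tip of the
    wing at [q].

    The record [winged_circle] isolates this self-similar structure: an angle
    function, which collapses each wing to its site, maps [wing d] onto the wings,
    and retractions [unwing d] that undo them and send the rest of the space to
    the bottom. The angles of the successive retractions of a point determine it
    ([angle_separates]). Everything else follows from this:
    - countably many continuous functions separate the points of a compact space,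
      which is therefore metrizable ([separating_metrizable]);
    - for each finite list [s] of sites, the set [rims s] of the points sent to
      the base circle by the retraction along [s] is a circle. Points that are
      not on a common [rims s] are separated by a site of some circle
      ([site_split]), so that a topological circle, which has no cut point, is
      contained in one of the [rims s] and hence equal to it ([circleP]);
    - two circles are separated by a circle close to the site at which the wing
      that contains one of them, but not the other, is attached
      ([circle_between]);
    - a point on no circle lies in a nested sequence of wings. Outside each wing
      there are at most two connected pieces, one attached to its bottom and one
      to its top ([nested_step]); a point of a circle is treated in the same way
      inside the last wing ([on_circle_crowded]). Thus all orders are at most 2
      ([winged_circle_airplane]).

    It remains to find this structure on the limit space. Its points are infinite
    words in the seven letters of the replacement graphs, and two words are glued
    exactly when they are equal or follow two edges to the same vertex of a
    replacement graph ([piP]). The angle of a word reads its red letters in binary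
    ([ang]); wings add and remove prefixes; words with the same angles are glued
    ([angles_separate_words]). Connectedness and local connectedness come from the
    cells, the sets of the points whose words have a given prefix
    ([cell_connected], [airplane_locally_connected]). *)

Local Open Scope classical_set_scope.
Local Open Scope ring_scope.

(** * General topology *)

Lemma continuous_image_connected (T U : topologicalType) (f : T -> U) A :
  continuous f -> connected A -> connected (f @` A).
Proof.
by move=> cf cA; apply: connected_continuous_connected => //; exact: continuous_subspaceT.
Qed.

Lemma continuous_image_compact (T U : topologicalType) (f : T -> U) A :
  continuous f -> compact A -> compact (f @` A).
Proof.
by move=> cf cA; apply: continuous_compact => //; exact: continuous_subspaceT.
Qed.

Definition sub_point (T : Type) (A : set T) x (Ax : A x) : A :=
  exist (fun x => x \in A) x (mem_set Ax).

Lemma sub_pointP (T : Type) (A : set T) (x : A) : A (set_val x).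
Proof. exact: set_mem (valP x). Qed.

Lemma set_val_continuous (T : topologicalType) (A : set T) :
  continuous (set_val : A -> T).
Proof. exact: initial_continuous. Qed.

Lemma continuous_sub (T U : topologicalType) (A : set U) (f : T -> A) :
  continuous (set_val \o f) -> continuous f.
Proof. exact: continuous_comp_initial. Qed.

Lemma continuous_at_pair (T U V : topologicalType) (f : T -> U) (g : T -> V) x :
  continuous_at x f -> continuous_at x g ->
  continuous_at x (fun t => (f t, g t)).
Proof. by move=> cf cg; apply: (@cvg_pair _ _ _ (nbhs x)). Qed.

Lemma compact_set_type (T : topologicalType) (A : set T) :
  compact A -> compact [set: A].
Proof.
move=> /compact_near_coveringP cA; apply/compact_near_coveringP => I F P FF cov.
have : \forall i \near F, A `<=` (fun x => forall Ax : x \in A, P i (exist _ x Ax)).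
  apply: cA => x Ax /=.
  have [[U V] /= [[W [[B oB <-] /= Bx BU]] FV] UV] := cov (sub_point Ax) Logic.I.
  exists (B, V); first by split=> //; exact: open_nbhs_nbhs.
  move=> [y j] /= [By Vj] Ay; apply: (UV (exist _ y Ay, j)); split=> //.
  exact: BU.
by apply: filterS => i Ai [x Ax] _; apply: Ai; exact: set_mem.
Qed.

Lemma connected_split (T : topologicalType) (E U V : set T) :
  connected E -> open U -> open V -> E `<=` U `|` V -> E `&` U `&` V = set0 ->
  E `<=` U \/ E `<=` V.
Proof.
move=> cE oU oV EUV EUV0; have [/set0P[x [Ex Ux]]|/negPn/eqP EU] :=
  boolP (E `&` U != set0); last first.
  right=> x Ex; case: (EUV x Ex) => // Ux.
  by suff : set0 x by []; rewrite -EU.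
left; have <- : E `&` U = E; last by move=> y [].
apply: cE; first by exists x.
  by exists U.
exists (~` V); first exact: open_closedC.
apply/seteqP; split=> y [Ey].
  by move=> Uy; split=> // Vy; suff : set0 y by []; rewrite -EUV0.
by move=> nVy; split=> //; case: (EUV y Ey).
Qed.

Lemma bigcup_connected_hub (T : topologicalType) (H : set T) I (D : set I)
    (A : I -> set T) : connected H -> H !=set0 ->
  (forall i, D i -> connected (A i)) -> (forall i, D i -> A i `&` H !=set0) ->
  connected (H `|` \bigcup_(i in D) A i).
Proof.
move=> cH [h Hh] cA AH.
have -> : H `|` \bigcup_(i in D) A i =
    \bigcup_(o in [set o | if o is Some i then D i else True])
       (if o is Some i then H `|` A i else H).
  apply/seteqP; split=> [x [Hx|[i Di Aix]]|x [[i|] /= Di]].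
  - by exists None.
  - by exists (Some i) => //; right.
  - by case=> [|Ax]; [left|right; exists i].
  - by left.
apply: bigcup_connected => [|[i|] /= Di //].
  by exists h => -[i|] // Di; left.
by apply: connectedU => //; [rewrite setIC; exact: AH|exact: cA].
Qed.

(** Connected neighborhoods need not be open: the component of a point in an
    open set is open because it contains such a neighborhood of its points. *)
Lemma weakly_locally_connected (X : topologicalType) :
  (forall (x : X) U, nbhs x U -> exists N, [/\ nbhs x N, connected N & N `<=` U]) ->
  locally_connected X.
Proof.
move=> wlc x U xU; exists (connected_component U° x).
have xU' : U° x by exact: xU.
split; last first.
- by move=> y /connected_component_sub; exact: interior_subset.
- exact: component_connected.
- exact: connected_component_refl.
rewrite openE => y yV.
have yU : nbhs y U° by apply: nbhs_interior; exact: (connected_component_sub yV).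
have [N [yN cN NU]] := wlc y _ yU; apply: (filterS _ yN).
rewrite (same_connected_component yV).
by apply: connected_component_max => //; exact: nbhs_singleton.
Qed.

(** A continuous injection of a compact set in a Hausdorff space is an
    embedding: it maps closed subsets, which are compact, to closed sets. *)
Lemma compact_embedding (T U : topologicalType) (A : set T) (B : set U)
    (f : T -> U) : hausdorff_space U -> compact A -> continuous f ->
  f @` A = B -> (forall x y, A x -> A y -> f x = f y -> x = y) ->
  homeomorphic (set_type A) (set_type B).
Proof.
move=> hU cA cf fAB finj.
have fB (x : A) : f (set_val x) \in B.
  by rewrite inE -fAB; exists (set_val x) => //; exact: sub_pointP x.
have gA (y : B) : exists x : A, f (set_val x) = set_val y.
  have [x Ax <-] : (f @` A) (set_val y) by rewrite fAB; exact: sub_pointP y.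
  by exists (sub_point Ax).
pose F (x : A) : B := exist _ (f (set_val x)) (fB x).
pose G (y : B) : A := projT1 (cid (gA y)).
have GE y : f (set_val (G y)) = set_val y by exact: (projT2 (cid (gA y))).
have GK : cancel G F by move=> y; apply: val_inj; exact: GE.
have FK : cancel F G.
  move=> x; apply: val_inj; apply: finj; [exact: sub_pointP..|].
  by rewrite -!set_valE GE.
exists F, G; split=> //.
  apply: continuous_sub; have -> : set_val \o F = f \o set_val by [].
  by move=> x; apply: continuous_comp; [exact: set_val_continuous|exact: cf].
apply/continuousP => _ [V oV <-].
have cAV : closed (f @` (A `&` ~` V)).
  apply: compact_closed => //; apply: continuous_image_compact => //.
  by apply: compact_closedI => //; exact: open_closedC.
exists (~` (f @` (A `&` ~` V))); first exact: closed_openC.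
apply/seteqP; split=> y /=.
  move=> nV; apply: contrapT => VG; apply: nV.
  by exists (set_val (G y)); [split=> //; exact: sub_pointP|exact: GE].
move=> VG [x [Ax nVx]] fx; apply: nVx.
suff -> : x = set_val (G y) by [].
by apply: finj => //; [exact: sub_pointP|rewrite GE].
Qed.

(** * Metrization *)

Section Metrization.
Context (R : realType) (T : topologicalType) (f : nat -> T -> R).
Hypothesis f_cont : forall n, continuous (f n).
Hypothesis f_bound : forall n x, `|f n x| <= 1.
Hypothesis f_sep : forall x y, (forall n, f n x = f n y) -> x = y.

Let gap (x y : T) n : R := `|f n x - f n y| / n.+1%:R.

Let gap_bound x y n : gap x y n <= 2 / n.+1%:R.
Proof.
rewrite /gap ler_wpM2r ?invr_ge0 // (le_trans (ler_normB _ _)) //.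
by rewrite (_ : 2 = 1 + 1 :> R) // lerD.
Qed.

(** The weights [1 / n.+1] make all but finitely many terms negligible, so that
    this distance is continuous. *)
Definition sup_dist (x y : T) : R := sup (range (gap x y)).

Let gap_ub x y : has_ubound (range (gap x y)).
Proof.
exists 2 => _ [n _ <-]; apply: le_trans (gap_bound x y n) _.
by rewrite ler_piMr // invf_le1 // ler1n.
Qed.

Let gap_le x y n : gap x y n <= sup_dist x y.
Proof. by apply: (ub_le_sup (gap_ub x y)); exists n. Qed.

Let dist_le x y e : (forall n, gap x y n <= e) -> sup_dist x y <= e.
Proof.
move=> le_e; apply: ge_sup; first by exists (gap x y 0), 0%N.
by move=> _ [n _ <-].
Qed.

Lemma sup_distxx x : sup_dist x x = 0.
Proof.
have gap0 n : gap x x n = 0 by rewrite /gap subrr normr0 mul0r.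
apply/eqP; rewrite eq_le dist_le /= => [|n]; last by rewrite gap0.
by rewrite -(gap0 0%N) gap_le.
Qed.

Lemma sup_dist_eq0 x y : sup_dist x y = 0 -> x = y.
Proof.
move=> d0; apply: f_sep => n; apply/eqP; rewrite -subr_eq0 -normr_le0.
by have := gap_le x y n; rewrite d0 /gap pmulr_lle0.
Qed.

Lemma sup_dist_sym x y : sup_dist x y = sup_dist y x.
Proof.
by congr sup; apply: eq_imagel => n _; rewrite /gap distrC.
Qed.

Lemma sup_dist_triangle y x z : sup_dist x z <= sup_dist x y + sup_dist y z.
Proof.
apply: dist_le => n; apply: le_trans (lerD (gap_le x y n) (gap_le y z n)).
by rewrite /gap -mulrDl ler_wpM2r ?invr_ge0 // ler_distD.
Qed.

Definition sup_metric : Type := T.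
HB.instance Definition _ := Choice.on sup_metric.
HB.instance Definition _ := @isMetric.Build R sup_metric sup_dist
  sup_distxx sup_dist_eq0 sup_dist_sym sup_dist_triangle.

Lemma sup_metric_continuous : continuous (id : T -> sup_metric).
Proof.
move=> x U /nbhs_ballP[e /= e0 eU].
have [N Ne] : exists N, 2 / N.+1%:R < e.
  have /archi_boundP := divr_ge0 (ler0n R 2) (ltW e0).
  set m := Num.bound _ => mb; exists m.
  rewrite ltr_pdivrMr ?ltr0n // mulrC -ltr_pdivrMr //.
  by apply: lt_trans mb _; rewrite ltr_nat.
have e20 : 0 < e / 2 by rewrite divr_gt0.
have near_small n : \forall y \near x, `|f n x - f n y| < e / 2.
  by have /cvgrPdist_lt := @f_cont n x; apply.
suff : \forall y \near x, forall n, (n <= N)%N -> `|f n x - f n y| < e / 2.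
  rewrite /= !nbhs_simpl /=; apply: filterS => y small; apply: eU.
  rewrite ballEmdist /= /mdist /=; apply: le_lt_trans (_ : Num.max (e / 2) (2 / N.+1%:R) < e).
    apply: dist_le => n; rewrite le_max.
    have [nN|Nn] := leqP n N.
      apply/orP; left; apply: le_trans (ltW (small n nN)).
      by rewrite ler_pdivrMr ?ltr0n // ler_peMr // ler1n.
    apply/orP; right; apply: le_trans (gap_bound x y n) _.
    by rewrite ler_wpM2l // lef_pV2 ?posrE ?ltr0n // ler_nat ltnW.
  by rewrite gt_max Ne andbT ltr_pdivrMr // ltr_pMr // ltr1n.
elim: N {Ne} => [|N IH].
  by apply: filterS (near_small 0%N) => y ? [|].
have := near_small N.+1; apply: filterS2 IH => y IH SN n.
by rewrite leq_eqVlt => /orP[/eqP->//|]; exact: IH.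
Qed.

(** The distance is continuous, so that the identity is a continuous bijection
    from a compact space to a metric one, hence a homeomorphism. *)
Lemma separating_metrizable : compact [set: T] -> metrizable R T.
Proof.
move=> cT; exists sup_metric; exists id, id; split=> //.
  exact: sup_metric_continuous.
apply/continuousP => A oA; rewrite -[_ @^-1` _]setCK.
apply: closed_openC; apply: compact_closed; first exact: metric_hausdorff.
have -> : ~` (id @^-1` A : set sup_metric) = (id : T -> sup_metric) @` (~` A).
  by rewrite image_id.
apply: continuous_image_compact; first exact: sup_metric_continuous.
by apply: subclosed_compact cT _ => //; exact: open_closedC.
Qed.

Lemma separating_hausdorff : hausdorff_space T.
Proof.
move=> x y xy; apply: (@metric_hausdorff R sup_metric) => A B Ax By.
exact: xy (sup_metric_continuous Ax) (sup_metric_continuous By).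
Qed.
End Metrization.

(** * The unit circle *)
Section Circle.
Context (R : realType).

(** The stereographic projection from [z], which is the one from [(1, 0)] after a
    rotation that brings [z] to [(1, 0)]. *)
Definition stereo (z w : R * R) : R :=
  (w.2 * z.1 - w.1 * z.2) / (1 - (w.1 * z.1 + w.2 * z.2)).

(** The product, as complex numbers, of [z] and of the usual rational
    parametrization of the circle minus [(1, 0)]. *)
Definition stereo_inv (z : R * R) (t : R) : R * R :=
  let u := (t ^+ 2 - 1) / (t ^+ 2 + 1) in let v := 2 * t / (t ^+ 2 + 1) in
  (z.1 * u - z.2 * v, z.1 * v + z.2 * u).

Lemma stereo_den (z w : R * R) : unit_circle R z -> unit_circle R w -> w <> z ->
  1 - (w.1 * z.1 + w.2 * z.2) != 0.
Proof.
case: z w => [a b] [x y]; rewrite /unit_circle /= => ab xy nz.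
apply/eqP => den0; apply: nz.
have : (x - a) ^+ 2 + (y - b) ^+ 2 = 0 by lra.
move=> /eqP; rewrite paddr_eq0 ?sqr_ge0 // !sqrf_eq0 !subr_eq0.
by move=> /andP[/eqP-> /eqP->].
Qed.

Lemma sqr1_neq0 (t : R) : t ^+ 2 + 1 != 0.
Proof. by rewrite gt_eqF // ltr_wpDl // sqr_ge0. Qed.

Lemma stereo_inv_circle z t : unit_circle R z -> unit_circle R (stereo_inv z t).
Proof.
case: z => a b; rewrite /unit_circle /stereo_inv /= => ab.
have s0 := sqr1_neq0 t.
transitivity ((a ^+ 2 + b ^+ 2) * 1); last by rewrite ab mulr1.
by field.
Qed.

Lemma stereo_inv_neq z t : unit_circle R z -> stereo_inv z t <> z.
Proof.
case: z => a b; rewrite /unit_circle /stereo_inv /= => ab [E1 E2].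
have s0 := sqr1_neq0 t.
have : (a ^+ 2 + b ^+ 2) * ((t ^+ 2 - 1) / (t ^+ 2 + 1) - 1) = 0.
  set u := _ / _ in E1 E2 *; set v := _ / _ in E1 E2.
  have -> : (a ^+ 2 + b ^+ 2) * (u - 1) =
    a * (a * u - b * v - a) + b * (a * v + b * u - b) by ring.
  by rewrite E1 E2 !subrr !mulr0 addr0.
rewrite ab mul1r => /eqP; rewrite subr_eq0 => /eqP /(canRL (mulfVK s0)).
by rewrite mul1r => /addrI /eqP; rewrite eqNr oner_eq0.
Qed.

Lemma stereoK z w : unit_circle R z -> unit_circle R w -> w <> z ->
  stereo_inv z (stereo z w) = w.
Proof.
move=> Cz Cw /(stereo_den Cz Cw); rewrite /stereo_inv /stereo.
case: z w Cz Cw => [a b] [x y]; rewrite /unit_circle /= => ab xy d0.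
have E : (y * a - x * b) ^+ 2 =
   (1 - (x * a + y * b)) * (1 + (x * a + y * b)).
  have -> : (y * a - x * b) ^+ 2 =
    (a ^+ 2 + b ^+ 2) * (x ^+ 2 + y ^+ 2) - (x * a + y * b) ^+ 2 by ring.
  by rewrite ab xy; ring.
set d := 1 - _ in d0 E *; set n := y * a - x * b in E *.
have dE : 1 + (x * a + y * b) = 2 - d by rewrite /d; ring.
rewrite dE in E.
have t1 : (n / d) ^+ 2 + 1 = 2 / d.
  by rewrite exprMn exprVn E; field.
have t2 : (n / d) ^+ 2 - 1 = 2 / d - 2 by lra.
have -> : ((n / d) ^+ 2 - 1) / ((n / d) ^+ 2 + 1) = 1 - d.
  by rewrite t1 t2; field.
have -> : 2 * (n / d) / ((n / d) ^+ 2 + 1) = n.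
  by rewrite t1; field.
rewrite /n /d; congr (_, _).
  transitivity (x * (a ^+ 2 + b ^+ 2)); last by rewrite ab mulr1.
  by ring.
transitivity (y * (a ^+ 2 + b ^+ 2)); last by rewrite ab mulr1.
by ring.
Qed.

Lemma stereo_inv_continuous z : continuous (stereo_inv z).
Proof.
move=> t; have s0 := sqr1_neq0 t.
have ct : {for t, continuous (fun s : R => s ^+ 2)} by exact: exprn_continuous.
have cd : {for t, continuous (fun s : R => (s ^+ 2 + 1)^-1)}.
  by apply: cvgV => //; apply: cvgD => //; exact: cvg_cst.
have cu : {for t, continuous (fun s : R => (s ^+ 2 - 1) / (s ^+ 2 + 1))}.
  by apply: cvgM => //; apply: cvgB => //; exact: cvg_cst.
have cv : {for t, continuous (fun s : R => 2 * s / (s ^+ 2 + 1))}.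
  by apply: cvgM => //; apply: cvgM => //; exact: cvg_cst.
rewrite /stereo_inv /=; apply: (@continuous_at_pair R R R).
  by apply: cvgB; apply: cvgM => //; exact: cvg_cst.
by apply: cvgD; apply: cvgM => //; exact: cvg_cst.
Qed.

Lemma stereo_continuous_at z w : unit_circle R z -> unit_circle R w -> w <> z ->
  {for w, continuous (stereo z)}.
Proof.
move=> Cz Cw wz; have d0 := stereo_den Cz Cw wz; rewrite /stereo.
have c1 : {for w, continuous (fun w : R * R => w.1)} by exact: cvg_fst.
have c2 : {for w, continuous (fun w : R * R => w.2)} by exact: cvg_snd.
apply: cvgM; [apply: cvgB|apply: cvgV => //; apply: cvgB; [|apply: cvgD]];
  by [exact: cvg_cst|apply: cvgM => //; exact: cvg_cst].
Qed.

Lemma circle_del_connected (z : unit_circle R) : connected (~` [set z]).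
Proof.
have Cz : unit_circle R (set_val z) by exact: sub_pointP z.
pose g (t : R) : unit_circle R :=
  sub_point (stereo_inv_circle t Cz).
have -> : ~` [set z] = g @` setT.
  apply/seteqP; split=> [w /= wz|_ [t _ <-] /= gz]; last first.
    by apply: (@stereo_inv_neq (set_val z) t) => //; rewrite -[in RHS]gz.
  exists (stereo (set_val z) (set_val w)) => //; apply: val_inj => /=.
  apply: stereoK => //; first exact: sub_pointP w.
  by move=> wz'; apply: wz; apply: val_inj.
apply: continuous_image_connected; last exact/connected_intervalP.
by apply: continuous_sub; exact: stereo_inv_continuous.
Qed.

Lemma unit_circle_east : unit_circle R (1, 0).
Proof. by rewrite /unit_circle /= expr1n expr0n addr0. Qed.

Lemma unit_circle_west : unit_circle R (-1, 0).
Proof. by rewrite /unit_circle /= sqrrN expr1n expr0n addr0. Qed.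

Lemma unit_circle_north : unit_circle R (0, 1).
Proof. by rewrite /unit_circle /= expr1n expr0n add0r. Qed.

Let east : unit_circle R := sub_point unit_circle_east.
Let west : unit_circle R := sub_point unit_circle_west.
Let north : unit_circle R := sub_point unit_circle_north.

Let ew : east <> west.
Proof. by move=> /(congr1 (fun z => (val z).1)) /= /eqP; rewrite eq_sym eqNr oner_eq0. Qed.
Let en : east <> north.
Proof. by move=> /(congr1 (fun z => (val z).1)) /= /eqP; rewrite oner_eq0. Qed.
Let wn : west <> north.
Proof. by move=> /(congr1 (fun z => (val z).1)) /= /eqP; rewrite oppr_eq0 oner_eq0. Qed.

Lemma circle_connected : connected [set: unit_circle R].
Proof.
have -> : [set: unit_circle R] = ~` [set east] `|` ~` [set west].
  apply/seteqP; split=> z // _; have [->|] := pselect (z = east); last by left.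
  by right=> /=; exact: ew.
apply: connectedU; [exists north; split=> /= /esym|..]; by [|exact: circle_del_connected].
Qed.

(** Removing from the circle the point with the middle one of three values would
    leave a connected set whose image is not an interval. *)
Lemma circle_no_injection (g : unit_circle R -> R) : continuous g ->
  ~ injective g.
Proof.
move=> cg ginj.
have mid (a b c : unit_circle R) : g a < g b -> g b < g c -> False.
  move=> ab bc.
  have := continuous_image_connected cg (@circle_del_connected b).
  move=> /connected_intervalP itv.
  have gaI : (g @` (~` [set b])) (g a).
    by exists a => // ab'; move: ab; rewrite ab' ltxx.
  have gcI : (g @` (~` [set b])) (g c).
    by exists c => // cb; move: bc; rewrite cb ltxx.
  have /(itv _ _ gaI gcI)[b' nb' /ginj b'b] : g a <= g b <= g c.
    by rewrite (ltW ab) (ltW bc).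
  exact: nb'.
have neq a b : a <> b -> g a != g b by move=> nab; apply/eqP => /ginj.
have := (neq _ _ ew, neq _ _ en, neq _ _ wn); rewrite !neq_lt.
by case=> [[/orP[] h1 /orP[] h2] /orP[] h3];
  eauto using mid.
Qed.
End Circle.

Section Circles.
Context (R : realType) (T : topologicalType) (A : set T).
Hypothesis circA : circle R A.

Lemma circleD1_connected x : connected (A `\ x).
Proof.
have [f [g [cf cg fK gK]]] := circA.
pose h (z : unit_circle R) : T := set_val (g z).
have ch : continuous h.
  by move=> z; apply: continuous_comp; [exact: cg|exact: set_val_continuous].
have hA z : A (h z) by exact: sub_pointP (g z).
have Ah y : A y -> exists z, h z = y.
  by move=> Ay; exists (f (sub_point Ay)); rewrite /h fK.
have hinj : injective h by move=> z w /val_inj; apply: (can_inj gK).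
have [Ax|nAx] := pselect (A x).
  have [z hz] := Ah x Ax.
  have -> : A `\ x = h @` (~` [set z]).
    apply/seteqP; split=> [y [Ay yx]|_ [w wz <-]].
      by have [w hw] := Ah y Ay; exists w => // wz; apply: yx; rewrite -hw wz.
    by split=> // /=; rewrite -hz => /hinj.
  apply: continuous_image_connected => //; exact: circle_del_connected.
have -> : A `\ x = h @` setT.
  apply/seteqP; split=> [y [Ay yx]|_ [w wz <-]].
    by have [w hw] := Ah y Ay; exists w.
  by split=> // /= hx; apply: nAx; rewrite -hx.
apply: continuous_image_connected => //; exact: circle_connected.
Qed.

Lemma circle_two_points : exists x y, [/\ A x, A y & x <> y].
Proof.
have [f [g [cf cg fK gK]]] := circA.
exists (set_val (g (sub_point (unit_circle_east R)))).
exists (set_val (g (sub_point (unit_circle_west R)))).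
split; [exact: sub_pointP (g _)..|].
move=> /val_inj /(can_inj gK) /(congr1 (fun z => (val z).1)) /= /eqP.
by rewrite eq_sym eqNr oner_eq0.
Qed.

(** No circle is properly contained in another one: if [z] were missed, the
    stereographic projection from [z] would inject the circle in the line. *)
Lemma circle_onto (h : T -> R * R) z : continuous h ->
  (forall x y, A x -> A y -> h x = h y -> x = y) ->
  (forall x, A x -> unit_circle R (h x)) -> unit_circle R z ->
  exists2 x, A x & h x = z.
Proof.
move=> ch hinj hC Cz; apply: contrapT => nx.
have [f [g [cf cg fK gK]]] := circA.
have gA w : A (set_val (g w)) by exact: sub_pointP (g w).
have nz w : h (set_val (g w)) <> z by move=> hz; apply: nx; exists (set_val (g w)).
apply: (@circle_no_injection R (stereo z \o (h \o (set_val \o g)))).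
  move=> w; apply: continuous_comp.
    apply: continuous_comp; last exact: ch.
    by apply: continuous_comp; [exact: cg|exact: set_val_continuous].
  by apply: stereo_continuous_at; [exact: Cz|exact: (hC _ (gA _))|exact: nz].
have K w : stereo_inv z (stereo z (h (set_val (g w)))) = h (set_val (g w)).
  by apply: stereoK; [exact: Cz|exact: (hC _ (gA _))|exact: nz].
move=> w w' /= /(congr1 (stereo_inv z)); rewrite !K.
by move=> /hinj -/(_ (gA _) (gA _)) /val_inj /(can_inj gK).
Qed.
End Circles.

(** * Cut points and components *)

Section Components.
Context (T : topologicalType).
Implicit Types (x y : T) (E : set T).

Definition separating_split x U V y1 y2 :=
  [/\ open U, open V, U `&` V = set0, ~` [set x] = U `|` V & U y1 /\ V y2].

Lemma split_not_connected E U V y1 y2 : open U -> open V -> U `&` V = set0 ->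
  E `<=` U `|` V -> U y1 -> V y2 -> E y1 -> E y2 -> ~ connected E.
Proof.
move=> oU oV UV EUV Uy1 Vy2 Ey1 Ey2 cE.
have UV0 y : U y -> V y -> False.
  by move=> Uy Vy; suff : set0 y by []; rewrite -UV.
have EUV0 : E `&` U `&` V = set0 by rewrite -setIA UV setI0.
have [EU|EV] := connected_split cE oU oV EUV EUV0.
- exact: UV0 (EU _ Ey2) Vy2.
- exact: UV0 Uy1 (EV _ Ey1).
Qed.

Lemma split_components E U V y1 y2 : open U -> open V -> U `&` V = set0 ->
  E `<=` U `|` V -> U y1 -> V y2 -> E y2 ->
  connected_component E y1 <> connected_component E y2.
Proof.
move=> oU oV UV EUV Uy1 Vy2 Ey2 ceq.
have cy2 : connected_component E y1 y2.
  by rewrite ceq; exact: connected_component_refl.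
apply: (@split_not_connected (connected_component E y1) U V y1 y2) => //.
- by move=> y /connected_component_sub /EUV.
- apply: connected_component_refl.
  by case: cy2 => B [By1 BE _] _; exact: BE.
- exact: component_connected.
Qed.

Lemma card_pair (S : Type) (a b : S) : a <> b -> ([set a; b] #= `I_2)%card.
Proof.
move=> ab; pose f (n : nat) := if n == 0%N then a else b.
have -> : [set a; b] = f @` `I_2.
  apply/seteqP; split=> [c [->|->]|_ [[|n] _ <-]]; last 2 first.
  - by left.
  - by right.
  - by exists 0%N.
  - by exists 1%N.
apply: inj_card_eq => -[|[|m]] [|[|n]] //; rewrite ?inE //=;
  by rewrite /f //= => _ _ /esym ?; case: ab.
Qed.

Lemma split_cut_point x U V y1 y2 : separating_split x U V y1 y2 -> cut_point x.
Proof.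
move=> [oU oV UV xUV [Uy1 Vy2]].
have y1x : (~` [set x]) y1 by rewrite xUV; left.
have y2x : (~` [set x]) y2 by rewrite xUV; right.
have cneq : connected_component (~` [set x]) y1 <>
            connected_component (~` [set x]) y2.
  by apply: (split_components oU oV) => //; rewrite xUV.
rewrite /cut_point -(card_le_eql (card_pair cneq)); apply: subset_card_le.
by move=> _ [->|->]; [exists y1|exists y2].
Qed.

(** This form of the bound 2 on the number of components is suited to a
    complement exhausted by a sequence of sets with two pieces each: any three
    points lie in one of these sets. *)
Definition crowded x := forall y1 y2 y3, y1 <> x -> y2 <> x -> y3 <> x ->
  exists2 E, connected E /\ E `<=` ~` [set x] &
    [\/ E y1 /\ E y2, E y1 /\ E y3 | E y2 /\ E y3].

Lemma crowded_order_two x : crowded x -> cut_point x -> order_two x.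
Proof.
move=> crx /card_leP/unsquash f.
set C := complement_components x in f *.
pose c (i : nat) (i2 : (i < 2)%N) := f (sub_point (i2 : `I_2 i)).
have [y1 y1x y1E] : C (set_val (c 0%N isT)) by exact: sub_pointP.
have [y2 y2x y2E] : C (set_val (c 1%N isT)) by exact: sub_pointP.
have cneq : connected_component (~` [set x]) y1 <>
            connected_component (~` [set x]) y2.
  by rewrite y1E y2E => /val_inj /(@inj _ _ _ f); rewrite !inE => /(_ Logic.I Logic.I) [].
have same E y y' : connected E -> E `<=` ~` [set x] -> E y -> E y' ->
    connected_component (~` [set x]) y = connected_component (~` [set x]) y'.
  by move=> cE Ex Ey Ey'; apply: same_connected_component; exists E.
rewrite /order_two; suff -> : complement_components x = [set connected_component (~` [set x]) y1;
  connected_component (~` [set x]) y2] by exact: card_pair.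
apply/seteqP; split=> [_ [y yx <-]|_ [->|->]]; [|by exists y1|by exists y2].
have [E [cE Ex] [[E1 E2]|[E1 E2]|[E1 E2]]] := crx y1 y2 y y1x y2x yx.
- by case: cneq; exact: (same E).
- by left; exact: (same E).
- by right; exact: (same E).
Qed.

Lemma two_pieces_crowded x A B : connected A -> connected B ->
  ~` [set x] = A `|` B -> crowded x.
Proof.
move=> cA cB xAB y1 y2 y3 y1x y2x y3x.
have AB y : y <> x -> A y \/ B y by move=> yx; have : (~` [set x]) y by []; rewrite xAB.
have Ax : A `<=` ~` [set x] by rewrite xAB; left.
have Bx : B `<=` ~` [set x] by rewrite xAB; right.
by case: (AB _ y1x) (AB _ y2x) (AB _ y3x) => [?|?] [?|?] [?|?];
  (try by exists A => //; (constructor 1 + constructor 2 + constructor 3));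
  exists B => //; (constructor 1 + constructor 2 + constructor 3).
Qed.

Lemma connected_pairwise E : (forall y1 y2, E y1 -> E y2 ->
   exists2 C : set T, connected C /\ C `<=` E & C y1 /\ C y2) -> connected E.
Proof.
move=> cE; have [->|/set0P[y0 Ey0]] := eqVneq E set0; first exact: (@connected0 T).
have -> : E = \bigcup_(C in [set C : set T | [/\ connected C, C `<=` E & C y0]]) C.
  apply/seteqP; split=> [y Ey|y [C [_ CE _] Cy]]; last exact: CE.
  by have [C [cC CE] [Cy0 Cy]] := cE _ _ Ey0 Ey; exists C.
by apply: bigcup_connected => [|C []]; first by exists y0 => C [].
Qed.

Lemma connectedU_or (A B : set T) : connected A -> connected B ->
  A = set0 \/ A `&` B !=set0 -> connected (A `|` B).
Proof. by move=> cA cB [->|AB]; [rewrite set0U|exact: connectedU]. Qed.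
End Components.

(** * Winged circles *)

Section Iterates.
Context (T I : Type) (wing unwing : I -> T -> T).
Fixpoint wings_of (s : seq I) (x : T) : T :=
  if s is d :: s' then wing d (wings_of s' x) else x.
Fixpoint unwings_of (s : seq I) (x : T) : T :=
  if s is d :: s' then unwings_of s' (unwing d x) else x.

Lemma wings_of_cat s t x : wings_of (s ++ t) x = wings_of s (wings_of t x).
Proof. by elim: s => //= d s ->. Qed.

Lemma unwings_of_cat s t x :
  unwings_of (s ++ t) x = unwings_of t (unwings_of s x).
Proof. by elim: s x => //= d s IH x. Qed.
End Iterates.

(** [sp] and [sq] are the sites of the wings that contain the ends [bottom] and
    [top] of the space, at the tips of these wings. Every wing is attached by its
    bottom. *)
Record winged_circle (R : realType) (T : topologicalType) := WingedCircle {
  site : countType;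
  sp : site;
  sq : site;
  bottom : T;
  top : T;
  angle : T -> R * R;
  wing : site -> T -> T;
  unwing : site -> T -> T;
  angle_continuous : continuous angle;
  wing_continuous : forall d, continuous (wing d);
  unwing_continuous : forall d, continuous (unwing d);
  angle_circle : forall x, unit_circle R (angle x);
  wingK : forall d, cancel (wing d) (unwing d);
  unwingK : forall d x, unwing d x <> bottom -> wing d (unwing d x) = x;
  angle_wing : forall d x, angle (wing d x) = angle (wing d bottom);
  site_inj : forall d e, angle (wing d bottom) = angle (wing e bottom) -> d = e;
  spq : sp <> sq;
  wing_sp_top : wing sp top = bottom;
  wing_sq_top : wing sq top = top;
  angle_onto : forall z, unit_circle R z ->
    exists2 x, angle x = z & forall d, unwing d x = bottom;
  angle_separates : forall x y,
    (forall s, angle (unwings_of unwing s x) = angle (unwings_of unwing s y)) ->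
    x = y;
  sites_dense : forall O : set T, open O -> O !=set0 ->
    exists s d, O (wings_of wing s (wing d bottom))
}.

Section WingedCircle.
Context (R : realType) (T : topologicalType) (W : winged_circle R T).
Notation I := (site W).
Notation p := (sp W).
Notation q := (sq W).
Notation io := (bottom W).
Notation ta := (top W).
Notation angle := (angle W).
Notation wing := (@wing R T W).
Notation unwing := (@unwing R T W).
Notation wings := (wings_of wing).
Notation unwings := (unwings_of unwing).
Implicit Types (x y : T) (d e : I) (s t : seq I).

Lemma unwing_wing d e x : d <> e -> unwing e (wing d x) = io.
Proof.
move=> de; apply: contrapT => /unwingK /(congr1 angle).
by rewrite !angle_wing => /site_inj /esym.
Qed.

Lemma unwing_out d x : angle x <> angle (wing d io) -> unwing d x = io.
Proof.
by move=> xd; apply: contrapT => /unwingK xE; apply: xd; rewrite -xE angle_wing.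
Qed.

Lemma unwing_sp_bottom : unwing p io = ta.
Proof. by rewrite -{1}(wing_sp_top W) wingK. Qed.

Lemma unwing_bottom d : d <> p -> unwing d io = io.
Proof. by move=> dp; rewrite -{1}(wing_sp_top W) unwing_wing // => /esym. Qed.

Lemma unwing_sq_top : unwing q ta = ta.
Proof. by rewrite -{1}(wing_sq_top W) wingK. Qed.

Lemma unwing_top d : d <> q -> unwing d ta = io.
Proof. by move=> dq; rewrite -{1}(wing_sq_top W) unwing_wing // => /esym. Qed.

Lemma angle_bottom : angle io = angle (wing p io).
Proof. by rewrite -{1}(wing_sp_top W) angle_wing. Qed.

Lemma angle_top : angle ta = angle (wing q io).
Proof. by rewrite -{1}(wing_sq_top W) angle_wing. Qed.

Lemma bottom_neq_top : io <> ta.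
Proof.
by move=> /(congr1 angle); rewrite angle_bottom angle_top => /site_inj /spq.
Qed.

Definition tip x := x = io \/ x = ta.

Lemma tip_unwings s x : tip x -> tip (unwings s x).
Proof.
elim: s x => //= d s IH x tx; apply: IH; case: tx => ->.
  have [->|dp] := pselect (d = p); first by right; exact: unwing_sp_bottom.
  by left; exact: unwing_bottom.
have [->|dq] := pselect (d = q); first by right; exact: unwing_sq_top.
by left; exact: unwing_top.
Qed.

Lemma wingsK s : cancel (wings s) (unwings s).
Proof. by elim: s => //= d s IH x /=; rewrite wingK IH. Qed.

Lemma unwingsK s x : ~ tip (unwings s x) -> wings s (unwings s x) = x.
Proof.
elim: s x => //= d s IH x nt; rewrite IH //; apply: unwingK => E.
by apply: nt; rewrite E; apply: tip_unwings; left.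
Qed.

Lemma unwings_cat s t x : unwings (s ++ t) x = unwings t (unwings s x).
Proof. exact: unwings_of_cat. Qed.

Lemma wings_cat s t x : wings (s ++ t) x = wings s (wings t x).
Proof. exact: wings_of_cat. Qed.

Lemma unwings_rcons s d x : unwings (rcons s d) x = unwing d (unwings s x).
Proof. by rewrite -cats1 unwings_cat. Qed.

Lemma wings_rcons s d x : wings (rcons s d) x = wings s (wing d x).
Proof. by rewrite -cats1 wings_cat. Qed.

Lemma wings_continuous s : continuous (wings s).
Proof.
elim: s => [|d s IH] x /=; first exact: cvg_id.
by apply: continuous_comp; [exact: IH|exact: wing_continuous].
Qed.

Lemma unwings_continuous s : continuous (unwings s).
Proof.
elim: s => [|d s IH] x /=; first exact: cvg_id.
by apply: continuous_comp; [exact: unwing_continuous|exact: IH].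
Qed.

Lemma angles_continuous s : continuous (angle \o unwings s).
Proof.
by move=> x; apply: continuous_comp; [exact: unwings_continuous|exact: angle_continuous].
Qed.

(** ** The circles *)

(** The base circle: the points that no retraction sees inside a wing. *)
Definition rim : set T := [set x | forall d, unwing d x = io].
Definition rims s : set T := unwings s @^-1` rim.

Lemma rims_cat s t x : rims (s ++ t) x = rims t (unwings s x).
Proof. by rewrite /rims /preimage /= unwings_cat. Qed.

Lemma rim_not_tip x : rim x -> ~ tip x.
Proof.
move=> rx [xE|xE].
  have := rx p; rewrite xE unwing_sp_bottom => /esym; exact: bottom_neq_top.
have := rx q; rewrite xE unwing_sq_top => /esym; exact: bottom_neq_top.
Qed.

Lemma rimsK s x : rims s x -> wings s (unwings s x) = x.
Proof. by move=> /rim_not_tip; exact: unwingsK. Qed.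

Lemma rims_wings s x : rim x -> rims s (wings s x).
Proof. by rewrite /rims /preimage /= wingsK. Qed.

Lemma rim_site d : rim (wing d io).
Proof.
move=> e; have [<-|de] := pselect (d = e); first by rewrite wingK.
by rewrite unwing_wing.
Qed.

Lemma not_rim x : ~ rim x ->
  exists d, unwing d x <> io /\ angle x = angle (wing d io).
Proof.
move=> /existsNP[d dx]; exists d; split=> //; apply: contrapT => /unwing_out.
exact: dx.
Qed.

Lemma rim_unwing_tip d s x : unwing d x = io -> ~ rims (d :: s) x.
Proof.
by move=> dx /rim_not_tip /=; rewrite dx; apply; apply: tip_unwings; left.
Qed.

(** A point of [rims (d :: s)] is inside the wing [d], away from its bottom, so
    that the circles through a point are found by following it from wing to
    wing. *)
Lemma rims_inj s t x : rims s x -> rims t x -> s = t.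
Proof.
elim: s t x => [|d s IH] [|e t] x // rs rt.
- by case: (rim_unwing_tip (rs e) rt).
- by case: (rim_unwing_tip (rt d) rs).
have [E|nd] := pselect (unwing d x = io); first by case: (rim_unwing_tip E rs).
have [E|ne] := pselect (unwing e x = io); first by case: (rim_unwing_tip E rt).
have de : d = e.
  apply: (@site_inj _ _ W); rewrite -(angle_wing d (unwing d x)).
  by rewrite -(angle_wing e (unwing e x)) !unwingK.
by rewrite -de; congr cons; apply: (IH t (unwing d x)) => //; rewrite de.
Qed.

Lemma rim_angle_inj x y : rim x -> rim y -> angle x = angle y -> x = y.
Proof.
move=> rx ry xy; apply: (@angle_separates _ _ W) => -[|d s] //=.
by rewrite rx ry.
Qed.

Lemma rims_angle_inj s x y : rims s x -> rims s y ->
  angle (unwings s x) = angle (unwings s y) -> x = y.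
Proof.
by move=> rx ry /(rim_angle_inj rx ry) E; rewrite -(rimsK rx) E rimsK.
Qed.

(** A site [d] of a circle cuts the space: the points beyond it in the wing and
    the points of other angles are both open conditions, by continuity of
    [unwing d] and of the angle. *)
Lemma site_split s d y1 y2 : hausdorff_space T ->
  unwing d (unwings s y1) <> io -> angle (unwings s y2) <> angle (wing d io) ->
  separating_split (wings s (wing d io))
    [set y | unwing d (unwings s y) <> io]
    [set y | angle (unwings s y) <> angle (wing d io)] y1 y2.
Proof.
move=> hT y1d y2d; have cl1 (x : T) : closed [set x].
  by apply: accessible_closed_set1; exact: hausdorff_accessible.
split=> //.
- have : open ((unwing d \o unwings s) @^-1` (~` [set io])).
    apply: open_comp; last exact: closed_openC.
    move=> y _; apply: continuous_comp; first exact: unwings_continuous.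
    exact: unwing_continuous.
  by [].
- have : open ((angle \o unwings s) @^-1` (~` [set angle (wing d io)])).
    apply: open_comp; first by move=> y _; exact: angles_continuous.
    apply: closed_openC; apply: accessible_closed_set1.
    by apply: hausdorff_accessible; exact: norm_hausdorff.
  by [].
- by apply/seteqP; split=> // y [/= /[swap] /unwing_out].
- apply/seteqP; split=> [y /= yz|y [] /= yd yz]; last 2 first.
  + by apply: yd; rewrite yz wingsK wingK.
  + by apply: yd; rewrite yz wingsK.
  have [yd|?] := pselect (unwing d (unwings s y) = io); last by left.
  have [ya|?] := pselect (angle (unwings s y) = angle (wing d io)); last by right.
  case: yz; have ry : rims s y.
    move=> e /=; have [<-//|de] := pselect (d = e).
    by apply: unwing_out; rewrite ya => /site_inj.
  apply: (@rims_angle_inj s) => //; last by rewrite wingsK.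
  by apply: rims_wings; exact: rim_site.
Qed.

Hypothesis compactT : compact [set: T].

Definition coordinate (n : nat) (x : T) : R :=
  if unpickle n is Some (s, b) then
    if b then (angle (unwings s x)).1 else (angle (unwings s x)).2
  else 0.

Lemma coordinate_continuous n : continuous (coordinate n).
Proof.
rewrite /coordinate; case: (unpickle n) => [[s []]|] x; last exact: cvg_cst.
  by apply: (continuous_comp (@angles_continuous s x)); exact: cvg_fst.
by apply: (continuous_comp (@angles_continuous s x)); exact: cvg_snd.
Qed.

Lemma coordinate_bound n x : `|coordinate n x| <= 1.
Proof.
rewrite /coordinate; case: (unpickle n) => [[s b]|]; last by rewrite normr0.
have := angle_circle W (unwings s x); case: (angle _) => a c.
rewrite /unit_circle /= => ac; rewrite -(@ler_pXn2r _ 2) ?nnegrE //.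
by case: b; rewrite /= expr1n real_normK ?num_real // -ac ?lerDl ?lerDr sqr_ge0.
Qed.

Lemma coordinate_separates x y : (forall n, coordinate n x = coordinate n y) ->
  x = y.
Proof.
move=> xy; apply: (@angle_separates _ _ W) => s.
have := (xy (pickle (s, true)), xy (pickle (s, false))).
by rewrite /coordinate !pickleK; case: (angle _) (angle _) => [a b] [c d] /= [-> ->].
Qed.

Lemma winged_hausdorff : hausdorff_space T.
Proof.
exact: separating_hausdorff coordinate_continuous coordinate_bound
  coordinate_separates.
Qed.

Lemma winged_metrizable : metrizable R T.
Proof.
exact: separating_metrizable coordinate_continuous coordinate_bound
  coordinate_separates compactT.
Qed.

Let closed1 x : closed [set x].
Proof.
by apply: accessible_closed_set1; exact: hausdorff_accessible winged_hausdorff.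
Qed.

Lemma rims_closed s : closed (rims s).
Proof.
have -> : rims s = \bigcap_(d in setT) ((unwing d \o unwings s) @^-1` [set io]).
  by apply/seteqP; split=> x rx; [move=> d _|move=> d]; exact: rx.
apply: closed_bigI => d _; apply: preimage_closed => //.
move=> y _; apply: continuous_comp; first exact: unwings_continuous.
exact: unwing_continuous.
Qed.

Lemma rims_compact s : compact (rims s).
Proof. exact: subclosed_compact (@rims_closed s) compactT _. Qed.

Lemma rims_circle s : circle R (rims s).
Proof.
apply: (@compact_embedding _ _ (rims s) (unit_circle R) (angle \o unwings s)).
- exact: norm_hausdorff.
- exact: rims_compact.
- exact: angles_continuous.
- apply/seteqP; split=> [_ [x _ <-]|z Cz]; first exact: angle_circle.
  have [x <- rx] := angle_onto W Cz.
  by exists (wings s x); [exact: rims_wings|rewrite /= wingsK].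
- by move=> x y; exact: rims_angle_inj.
Qed.

(** A point off the circle [rims s] is beyond one of its sites, which separates
    it from every point of another angle. *)
Lemma off_rims_split s x y : ~ rims s x -> angle (unwings s x) <> angle (unwings s y) ->
  exists z U V, separating_split z U V x y.
Proof.
move=> /not_rim[d [dx xd]] xy.
exists (wings s (wing d io)); eexists; eexists; apply: site_split => //.
  exact: winged_hausdorff.
by rewrite -xd => /esym.
Qed.

Lemma separating_split_sym z U V x y : separating_split z U V x y ->
  separating_split z V U y x.
Proof. by case=> oU oV UV zUV [Ux Vy]; split=> //; rewrite 1?setIC 1?setUC. Qed.

(** Two points of a circle [A] are on a common [rims s], for otherwise a cut
    point would separate them and disconnect [A]. *)
Lemma circle_same_rims (A : set T) x y : circle R A -> A x -> A y -> x <> y ->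
  exists2 s, rims s x & rims s y.
Proof.
move=> cA Ax Ay xy; apply: contrapT => nrims.
have [s sxy] : exists s, angle (unwings s x) <> angle (unwings s y).
  apply: contrapT => /forallNP sep; apply: xy.
  by apply: (@angle_separates _ _ W) => s; apply: contrapT; exact: sep.
have [z [U [V [oU oV UV zUV [Ux Vy]]]]] :
    exists z U V, separating_split z U V x y.
  have [rx|nrx] := pselect (rims s x); last exact: off_rims_split sxy.
  have [ry|nry] := pselect (rims s y); first by case: nrims; exists s.
  have [z [U [V zUV]]] := off_rims_split nry (nesym sxy).
  by exists z, V, U; exact: separating_split_sym.
have nz v : (U `|` V) v -> v <> z by rewrite -zUV.
apply: (@split_not_connected _ (A `\ z) U V x y) => //.
- by rewrite -zUV => v [].
- by split=> //; apply: nz; left.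
- by split=> //; apply: nz; right.
- exact: circleD1_connected cA z.
Qed.

Lemma circleP (A : set T) : circle R A <-> exists s, A = rims s.
Proof.
split=> [cA|[s ->]]; last exact: rims_circle.
have [x [y [Ax Ay xy]]] := circle_two_points cA.
have [s sx sy] := circle_same_rims cA Ax Ay xy; exists s.
have As : A `<=` rims s.
  move=> z Az; have [->//|xz] := pselect (z = x).
  have [t tz tx] := circle_same_rims cA Az Ax xz.
  by rewrite (rims_inj sx tx).
apply/seteqP; split=> // z sz.
have [x' Ax' x'z] := circle_onto cA (@angles_continuous s)
  (fun x y Ax Ay => @rims_angle_inj s x y (As x Ax) (As y Ay))
  (fun x _ => angle_circle W (unwings s x)) (angle_circle W (unwings s z)).
by rewrite -(rims_angle_inj (As _ Ax') sz x'z).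
Qed.

Lemma rims_disjoint s t : s <> t -> rims s `&` rims t = set0.
Proof.
move=> st; apply/seteqP; split=> // x [sx tx].
by apply: st; exact: rims_inj sx tx.
Qed.
End WingedCircle.

Section WingedAirplane.
Context (R : realType) (T : topologicalType) (W : winged_circle R T).
Notation I := (site W).
Notation p := (sp W).
Notation q := (sq W).
Notation io := (bottom W).
Notation ta := (top W).
Notation angle := (angle W).
Notation wing := (@wing R T W).
Notation unwing := (@unwing R T W).
Notation wings := (wings_of wing).
Notation unwings := (unwings_of unwing).
Notation rim := (@rim R T W).
Notation rims := (@rims R T W).
Implicit Types (x y : T) (d e : I) (s t : seq I).

Hypothesis compactT : compact [set: T].
Hypothesis connectedT : connected [set: T].

Lemma site_on_circle s d : cut_point (wings s (wing d io)).
Proof.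
have [e ed] : exists e, e <> d.
  have [->|pd] := pselect (d = p); last by exists p; move=> /esym.
  by exists q; move=> /esym; exact: (@spq _ _ W).
apply: (@split_cut_point _ _ _ _ (wings s (wing d ta)) (wings s (wing e io))).
apply: site_split; first exact: (@winged_hausdorff R T W).
  by rewrite wingsK wingK; apply: nesym; exact: bottom_neq_top.
by rewrite wingsK => /site_inj.
Qed.

Lemma cut_circle_dense :
  dense [set x : T | cut_point x /\ exists2 A, circle R A & A x].
Proof.
move=> O O0 oO; have [s [d Osd]] := sites_dense W oO O0.
exists (wings s (wing d io)); split=> //; split; first exact: site_on_circle.
exists (rims s); first exact: (@rims_circle R T W compactT).
by apply: rims_wings; exact: rim_site.
Qed.

(** ** A third circle between two circles *)

Lemma unwings_nseq_bottom k : unwings (nseq k q) io = io.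
Proof. by elim: k => //= k IH; rewrite unwing_bottom //; by move=> /esym; exact: (@spq _ _ W). Qed.

Lemma unwings_nseq_top k : unwings (nseq k q) ta = ta.
Proof. by elim: k => //= k IH; rewrite unwing_sq_top. Qed.

(** Each retraction along [sq] either follows the address of the circle of [x] by
    one step or falls to the bottom and stays there. *)
Lemma unwings_nseq_rims s k x : rims s x -> (size s < k)%N ->
  unwings (nseq k q) x = io.
Proof.
elim: s k x => [|d s IH] [|k] x //= rx sk.
  by rewrite (rx q) unwings_nseq_bottom.
have [E|nE] := pselect (unwing q x = io); first by rewrite E unwings_nseq_bottom.
apply: IH sk; suff -> : q = d by [].
have [E|nd] := pselect (unwing d x = io); first by case: (rim_unwing_tip E rx).
apply: (@site_inj _ _ W); rewrite -(angle_wing q (unwing q x)).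
by rewrite -(angle_wing d (unwing d x)) !unwingK.
Qed.

(** The wing [d] is attached by its bottom, which lies at the tip of its own wing
    [sp], so that the circles of address [d, sp, sq, ..., sq] accumulate at the
    site [d]. If there are more copies of [sq] than the depth of the circle of
    [x], then [x] lies on one side of that circle, and everything outside the
    wing [d] on the other one. *)
Lemma circle_between d s x y : rims (d :: s) x -> unwing d y = io ->
  exists r, [/\ r <> [::], forall e t, e <> d -> r <> e :: t, r <> d :: s &
    angle (unwings r x) <> angle (unwings r y)].
Proof.
move=> rx dy; exists [:: d, p & nseq (size s).+1 q]; split=> //.
- by move=> e t ed [/esym].
- by move=> [/(congr1 size)] /=; rewrite size_nseq => /eqP; rewrite -[X in _ == X]addn0 -addn2 eqn_add2l.
have uE z : unwings [:: d, p & nseq (size s).+1 q] z =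
  unwings (nseq (size s).+1 q) (unwing p (unwing d z)) by [].
rewrite !uE dy unwing_sp_bottom unwings_nseq_top {uE}.
suff -> : unwings (nseq (size s).+1 q) (unwing p (unwing d x)) = io.
  by rewrite angle_bottom angle_top => /site_inj; exact: spq.
have [E|nE] := pselect (unwing p (unwing d x) = io).
  by rewrite E unwings_nseq_bottom.
case: s rx nE => [|e s] rx nE; first by case: nE; exact: rx.
apply: (@unwings_nseq_rims s) => //=.
have [E|ne] := pselect (unwing e (unwing d x) = io).
  by case: (@rim_unwing_tip _ _ W e s (unwing d x) E).
suff -> : p = e by [].
apply: (@site_inj _ _ W); rewrite -(angle_wing p (unwing p (unwing d x))).
by rewrite -(angle_wing e (unwing e (unwing d x))) !unwingK.
Qed.

Lemma circles_between s t x y : s <> t -> rims s x -> rims t y ->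
  exists r, [/\ r <> s, r <> t & angle (unwings r x) <> angle (unwings r y)].
Proof.
elim: s t x y => [|d s IH] [|e t] x y // st rx ry.
- have [r [r0 _ rt rxy]] := circle_between ry (rx e).
  by exists r; split=> //; exact: nesym.
- by have [r [r0 _ rs rxy]] := circle_between rx (ry d); exists r; split.
have [de|de] := pselect (d = e).
  have [||r [rs rt rxy]] := IH t (unwing d x) (unwing d y) _ rx; last 1 first.
  - by exists (d :: r); split=> //= -[]; rewrite -?de.
  - by move=> E; apply: st; rewrite de E.
  - by rewrite de.
have dy : unwing d y = io.
  apply: unwing_out; have [E|ne] := pselect (unwing e y = io).
    by case: (rim_unwing_tip E ry).
  by rewrite -(unwingK ne) angle_wing => /site_inj /esym.
have [r [_ ret rds rxy]] := circle_between rx dy.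
by exists r; split=> //; apply: ret; exact: nesym.
Qed.

Lemma circles_separated (A B : set T) x y :
  circle R A -> circle R B -> A <> B -> A x -> B y ->
  exists D : set T,
    [/\ circle R D, D <> A, D <> B, (~` D) x /\ (~` D) y
      & connected_component (~` D) x <> connected_component (~` D) y].
Proof.
move=> /(@circleP R T W compactT _)[s ->] /(@circleP R T W compactT _)[t ->] st sx ty.
have nst : s <> t by move=> E; apply: st; rewrite E.
have [r [rs rt rxy]] := circles_between nst sx ty.
have nrx : ~ rims r x by move=> rx; apply: rs; exact: rims_inj rx sx.
have nry : ~ rims r y by move=> ry; apply: rt; exact: rims_inj ry ty.
exists (rims r); split=> //.
- exact: (@rims_circle R T W compactT).
- by move=> E; apply: nrx; rewrite E.
- by move=> E; apply: nry; rewrite E.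
have [d [dx xd]] := not_rim nrx.
have [e [ey ye]] := not_rim nry.
have yd : angle (unwings r y) <> angle (wing d io) by rewrite -xd; exact: nesym.
have [oU oV UV zUV [Ux Vy]] := site_split (@winged_hausdorff R T W) dx yd.
apply: (split_components oU oV UV _ Ux Vy) => //; rewrite -zUV => z /= nrz zE.
by apply: nrz; rewrite zE; apply: rims_wings; exact: rim_site.
Qed.

(** ** Components of the complement of a point *)

(** The space without the open part of the wing [d]. *)
Definition body d : set T := [set x | unwing d x = io].

Let rim_circle : circle R rim.
Proof. exact: (@rims_circle R T W compactT [::]). Qed.

Let rim0 : rim !=set0.
Proof. by exists (wing p io); exact: rim_site. Qed.

Let wing_image_connected d : connected (wing d @` setT).
Proof. by apply: continuous_image_connected => //; exact: wing_continuous. Qed.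

Lemma rim_connected : connected rim.
Proof.
have -> : rim = rim `\ io; last exact: circleD1_connected rim_circle _.
apply/seteqP; split=> [x rx|x [] //]; split=> // xio.
by apply: (rim_not_tip rx); left.
Qed.

Lemma body_connected d : connected (body d).
Proof.
have -> : body d = rim `|` \bigcup_(e in [set e | e <> d]) (wing e @` setT).
  apply/seteqP; split=> [x dx|x [rx|[e ed [y _ <-]]]].
  - have [rx|/not_rim[e [ex _]]] := pselect (rim x); first by left.
    right; exists e => [ed|]; first by apply: ex; rewrite ed.
    by exists (unwing e x) => //; exact: unwingK.
  - exact: rx.
  - exact: unwing_wing.
apply: bigcup_connected_hub => [|//|e _|e _].
- exact: rim_connected.
- exact: wing_image_connected.
- by exists (wing e io); split; [exists io|exact: rim_site].
Qed.

(** Here [x] lies in the wing of address [s], and the rest of the space is made of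
    a part [A] attached to the bottom of that wing and a part [B] attached to its
    top, either of which may be missing. *)
Record nested (x : T) s (A B : set T) : Prop := Nested {
  nested_in : wings s (unwings s x) = x;
  nested_connected : connected A /\ connected B;
  nested_avoid : ~ A x /\ ~ B x;
  nested_cover : forall y, wings s (unwings s y) <> y -> A y \/ B y;
  nested_bottom : A = set0 \/ A (wings s io);
  nested_top : B = set0 \/ B (wings s ta) }.

Lemma nested_nil x : nested x [::] set0 set0.
Proof.
apply: Nested => [//|||y /(_ erefl)//||]; [| |by left|by left].
- by split; exact: (@connected0 T).
- by split.
Qed.

Lemma wings_inj s : injective (wings s).
Proof. exact: can_inj (@wingsK _ _ W s). Qed.

(** Shrinking the wing to its own wing [d] adds a copy of [body d] to the outside.
    It contains the bottom unless [d = sp] and the top unless [d = sq], and joins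
    the corresponding parts; the part that it does not join is attached to the
    tip of the wing [d]. *)
Lemma nested_step x s d A B : nested x s A B -> unwing d (unwings s x) <> io ->
  exists A' B', [/\ nested x (rcons s d) A' B', d = p -> B' = A & d = q -> B' = B].
Proof.
move=> [sx [cA cB] [nAx nBx] cov Abot Btop] dx.
pose N := wings s @` body d.
have cN : connected N.
  by apply: continuous_image_connected; [exact: wings_continuous|exact: body_connected].
have nNx : ~ N x.
  by move=> [y yd ys]; apply: dx; rewrite -ys wingsK; exact: yd.
have Nbot : N (wings (rcons s d) io).
  by rewrite wings_rcons; exists (wing d io) => //; exact: rim_site.
have inx : wings (rcons s d) (unwings (rcons s d) x) = x.
  by rewrite wings_rcons unwings_rcons unwingK.
have cov' y : wings (rcons s d) (unwings (rcons s d) y) <> y ->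
    N y \/ (A y \/ B y).
  rewrite wings_rcons unwings_rcons => ny.
  have [ys|ys] := pselect (wings s (unwings s y) = y); last by right; exact: cov.
  left; exists (unwings s y) => //.
  by apply: contrapT => /unwingK E; apply: ny; rewrite E.
have NA : d <> p -> A = set0 \/ A `&` N !=set0.
  move=> dp; case: Abot => [->|Abot]; [by left|right].
  by exists (wings s io); split=> //; exists io => //; exact: unwing_bottom.
have NB : d <> q -> B = set0 \/ B `&` N !=set0.
  move=> dq; case: Btop => [->|Btop]; [by left|right].
  by exists (wings s ta); split=> //; exists ta => //; exact: unwing_top.
have pq := @spq _ _ W.
have [dp|dp] := pselect (d = p).
  have dq : d <> q by rewrite dp.
  exists (B `|` N), A; split=> //; apply: Nested => //.
  - by split=> //; apply: connectedU_or => //; exact: NB.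
  - by split=> // -[].
  - by move=> y /cov'[|[|]] ?; [left; right|right|left; left].
  - by right; right.
  - case: Abot => [|Abot]; [by left|right].
    by rewrite wings_rcons dp wing_sp_top.
have [dq|dq] := pselect (d = q).
  exists (A `|` N), B; split=> //; apply: Nested => //.
  - by split=> //; apply: connectedU_or => //; exact: NA.
  - by split=> // -[].
  - by move=> y /cov'[|[|]] ?; [left; right|left; left|right].
  - by right; right.
  - case: Btop => [|Btop]; [by left|right].
    by rewrite wings_rcons dq wing_sq_top.
exists (A `|` (B `|` N)), set0; split=> //; apply: Nested => //.
- split; last exact: (@connected0 T).
  apply: connectedU_or => //; first by apply: connectedU_or => //; exact: NB.
  case: (NA dp) => [->|[y [Ay Ny]]]; [by left|right].
  by exists y; split=> //; right.
- by split=> // -[|[]].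
- by move=> y /cov'[|[|]] ?; [left; right; right|left; left|left; right; left].
- by right; right; right.
- by left.
Qed.

(** The wings nested around [x] shrink to [x], since the angles of two points that
    are in all of them agree: once an address leaves the sequence [d], both points
    fall to the bottom. *)
Lemma nested_shrink x (s : nat -> seq I) (d : nat -> I) y :
  s 0%N = [::] -> (forall k, s k.+1 = rcons (s k) (d k)) ->
  (forall k, unwing (d k) (unwings (s k) x) <> io) ->
  (forall k, wings (s k) (unwings (s k) y) = y) -> y = x.
Proof.
move=> s0 sS dx yk; apply: (@angle_separates _ _ W) => r.
have dy k : wing (d k) (unwing (d k) (unwings (s k) y)) = unwings (s k) y.
  by apply: (@wings_inj (s k)); rewrite -wings_rcons -unwings_rcons -sS !yk.
suff H k : angle (unwings r (unwings (s k) y)) = angle (unwings r (unwings (s k) x)).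
  by have := H 0%N; rewrite s0.
elim: r k => [|e r IH] k /=.
  by rewrite -(dy k) -(unwingK (dx k)) !angle_wing.
have [<-|de] := pselect (d k = e).
  by rewrite -!unwings_rcons -sS; exact: IH.
by rewrite -(dy k) -(unwingK (dx k)) !unwing_wing.
Qed.

Lemma nested_mono y (s : nat -> seq I) (d : nat -> I) k l :
  (forall k, s k.+1 = rcons (s k) (d k)) -> (k <= l)%N ->
  wings (s k) (unwings (s k) y) <> y -> wings (s l) (unwings (s l) y) <> y.
Proof.
move=> sS /subnK <-; elim: (l - k)%N => // m IH nk E; apply: IH nk _.
move: E; rewrite addSn sS -cats1 wings_cat => E.
by rewrite -{1}E wingsK.
Qed.

(** The wings around the bottom have addresses [sp, sq, ..., sq], so that the top
    part is empty from the first one on. *)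
Lemma deleted_bottom_connected : connected (~` [set io]).
Proof.
pose d k : I := if k is 0%N then p else q.
pose s := fix s k := if k is k'.+1 then rcons (s k') (d k') else [::].
have dio k : unwing (d k) (unwings (s k) io) = ta.
  elim: k => [|k IH]; first exact: unwing_sp_bottom.
  by rewrite [s _]/= unwings_rcons IH; exact: unwing_sq_top.
have dio' k : unwing (d k) (unwings (s k) io) <> io.
  by rewrite dio; apply: nesym; exact: bottom_neq_top.
have nest k : exists A, nested io (s k.+1) A set0.
  elim: k => [|k [A nA]].
    have [A [B [nA Bp _]]] := nested_step (nested_nil io) (dio' 0%N).
    by exists A; rewrite Bp in nA.
  have [A' [B' [nA' _ Bq]]] := nested_step nA (dio' k.+1).
  by exists A'; rewrite Bq in nA'.
have out y : y <> io -> exists k, wings (s k) (unwings (s k) y) <> y.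
  move=> yio; apply: contrapT => /forallNP yk; apply: yio.
  by apply: (@nested_shrink io s d y) => // k; apply: contrapT; exact: yk.
apply: connected_pairwise => y1 y2 /out[k1 k1y] /out[k2 k2y].
pose k := maxn k1 k2; have [A [_ [cA _] [nA _] cov _ _]] := nest k.
exists A; first by split=> // y Ay yio; apply: nA; rewrite -yio.
have inA j y : (j <= k)%N -> wings (s j) (unwings (s j) y) <> y -> A y.
  move=> jk jy; have [] := cov y => //.
  by apply: (@nested_mono y s d j k.+1) jy => //; exact: leqW.
by split; [apply: inA k1y; exact: leq_maxl|apply: inA k2y; exact: leq_maxr].
Qed.

(** A point on no circle is inside a wing at every depth. *)
Lemma off_circles_crowded x : (forall s, ~ rims s x) -> crowded x.
Proof.
move=> nrx; pose D s := projT1 (cid (not_rim (nrx s))).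
have Dx s : unwing (D s) (unwings s x) <> io.
  by case: (projT2 (cid (not_rim (nrx s)))).
pose s := fix s k := if k is k'.+1 then rcons (s k') (D (s k')) else [::].
have nest k : exists A B, nested x (s k) A B.
  elim: k => [|k [A [B nAB]]]; first by exists set0, set0; exact: nested_nil.
  by have [A' [B' [nAB' _ _]]] := nested_step nAB (Dx (s k)); exists A', B'.
have out y : y <> x -> exists k, wings (s k) (unwings (s k) y) <> y.
  move=> yx; apply: contrapT => /forallNP yk; apply: yx.
  by apply: (@nested_shrink x s (fun k => D (s k)) y) => // k; apply: contrapT; exact: yk.
move=> y1 y2 y3 /out[k1 k1y] /out[k2 k2y] /out[k3 k3y].
pose k := maxn k1 (maxn k2 k3).
have [A [B [_ [cA cB] [nA nB] cov _ _]]] := nest k.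
have inAB j y : (j <= k)%N -> wings (s j) (unwings (s j) y) <> y -> A y \/ B y.
  move=> jk jy; apply: cov.
  by apply: (@nested_mono y s (fun k => D (s k)) j) jy.
have Ax : A `<=` ~` [set x] by move=> y Ay yx; apply: nA; rewrite -yx.
have Bx : B `<=` ~` [set x] by move=> y By yx; apply: nB; rewrite -yx.
have := inAB _ _ _ k3y; rewrite !leq_max leqnn !orbT => /(_ isT).
have := inAB _ _ _ k2y; rewrite !leq_max leqnn !orbT => /(_ isT).
have := inAB _ _ _ k1y; rewrite !leq_max leqnn => /(_ isT).
by move=> [?|?] [?|?] [?|?];
  (try by exists A => //; (constructor 1 + constructor 2 + constructor 3));
  exists B => //; (constructor 1 + constructor 2 + constructor 3).
Qed.

Lemma nested_rims s t x : rims (s ++ t) x -> exists A B, nested x s A B.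
Proof.
elim/last_ind: s t => [|s d IH] t rx; first by exists set0, set0; exact: nested_nil.
rewrite cat_rcons in rx; have [A [B nAB]] := IH _ rx.
have [|A' [B' [nAB' _ _]]] := @nested_step x s d A B nAB; last by exists A', B'.
rewrite rims_cat in rx => E; exact: (rim_unwing_tip E rx).
Qed.

(** The points of other angles are the circle minus [x] and the wings attached to
    it; those of the same angle are in the open part of a wing at [x], if there
    is one. *)
Lemma deleted_rim x : rim x -> exists N F : set T,
  [/\ connected N, connected F, ~` [set x] = N `|` F,
    (forall y, F y -> angle y = angle x) & N !=set0].
Proof.
move=> rx; pose N := [set y | angle y <> angle x].
pose F := [set y | angle y = angle x /\ y <> x].
exists N, F; split=> //; last 2 first.
- by move=> y [].
- have [E|E] := pselect (angle io = angle x); last by exists io.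
  exists ta => /=; rewrite /N /= -E angle_bottom angle_top => /site_inj /esym.
  exact: (@spq _ _ W).
- have rxC : rim `\ x !=set0.
    have [a [b [ra rb ab]]] := circle_two_points rim_circle.
    have [ax|ax] := pselect (a = x); last by exists a.
    by exists b; split=> // bx; apply: ab; rewrite ax.
  have -> : N = (rim `\ x) `|` \bigcup_(e in [set e | angle (wing e io) <> angle x]) (wing e @` setT).
    apply/seteqP; split=> [y yx|y [[ry yx]|[e ex [z _ <-]]]].
    + have [ry|/not_rim[e [ey ye]]] := pselect (rim y).
        by left; split=> // yx'; apply: yx; rewrite yx'.
      right; exists e; first by rewrite /= -ye.
      by exists (unwing e y) => //; exact: unwingK.
    + by move=> E; apply: yx; exact: rim_angle_inj.
    + by move=> /=; rewrite /N /= angle_wing.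
  apply: bigcup_connected_hub => [|//|e _|e ex].
  + exact: circleD1_connected rim_circle _.
  + exact: wing_image_connected.
  + exists (wing e io); split; first by exists io.
    by split; [exact: rim_site|move=> /= E; apply: ex; rewrite E].
- have [[d dx]|nd] := pselect (exists d, x = wing d io); last first.
    have -> : F = set0; last exact: (@connected0 T).
    apply/seteqP; split=> // y [yx nyx].
    have [ry|/not_rim[e [ey ye]]] := pselect (rim y).
      by apply: nyx; exact: rim_angle_inj.
    apply: nd; exists e; apply: rim_angle_inj => //; last by rewrite -yx.
    exact: rim_site.
  have -> : F = wing d @` (~` [set io]).
    apply/seteqP; split=> [y [yx nyx]|_ [z zio <-]]; last first.
      split; first by rewrite angle_wing dx.
      by rewrite dx => /(can_inj (@wingK _ _ W d)).
    have [ry|/not_rim[e [ey ye]]] := pselect (rim y).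
      by case: nyx; exact: rim_angle_inj.
    have <- : e = d by apply: (@site_inj _ _ W); rewrite -ye yx dx.
    by exists (unwing e y) => //; exact: unwingK.
  apply: continuous_image_connected; first exact: wing_continuous.
  exact: deleted_bottom_connected.
- apply/seteqP; split=> [y yx|y [yx|[_ yx]]] //.
    by have [E|E] := pselect (angle y = angle x); [right|left].
  by move=> E; apply: yx; rewrite E.
Qed.

(** Inside the wing of address [s] the complement of [x] has the two pieces of
    [deleted_rim]; the outside parts are attached to its bottom and its top, which
    are not both in the second piece since they have distinct angles. *)
Lemma on_circle_crowded s x : rims s x -> crowded x.
Proof.
move=> rx; have [A [B [sx [cA cB] [nAx nBx] cov Abot Btop]]] :
    exists A B, nested x s A B by apply: (@nested_rims s [::]); rewrite cats0.
set x' := unwings s x in sx; have rx' : rim x' by [].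
have [N [F [cN cF x'NF FE _]]] := deleted_rim rx'.
have [cN' cF'] : connected (wings s @` N) /\ connected (wings s @` F).
  by split; apply: continuous_image_connected => //; exact: wings_continuous.
have xE : ~` [set x] = (A `|` B) `|` ((wings s @` N) `|` (wings s @` F)).
  apply/seteqP; split=> [y yx|y [[]|[]]].
  - have [ys|/cov] := pselect (wings s (unwings s y) = y); last by left.
    right; have : (~` [set x']) (unwings s y).
      by move=> /= E; apply: yx; rewrite -ys E.
    by rewrite x'NF => -[?|?]; [left|right]; exists (unwings s y).
  - by move=> Ay yx; apply: nAx; rewrite -yx.
  - by move=> By yx; apply: nBx; rewrite -yx.
  - move=> [z Nz <-] /= E; have : (N `|` F) z by left.
    by rewrite -x'NF; apply; apply: (@wings_inj s); rewrite sx.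
  - move=> [z Fz <-] /= E; have : (N `|` F) z by right.
    by rewrite -x'NF; apply; apply: (@wings_inj s); rewrite sx.
have tipNF y : tip W y -> N y \/ F y.
  move=> ty; have : (~` [set x']) y by move=> /= E; apply: (rim_not_tip rx'); rewrite -E.
  by rewrite x'NF.
have glue (E G : set T) y : connected E -> connected G -> E = set0 \/ E y ->
    G y -> connected (E `|` G).
  move=> cE cG Ey Gy; apply: connectedU_or => //.
  by case: Ey => [|Ey]; [left|right; exists y].
have [Nio|Fio] : N io \/ F io by apply: tipNF; left.
- have [Nta|Fta] : N ta \/ F ta by apply: tipNF; right.
    apply: (@two_pieces_crowded _ _ (A `|` (B `|` (wings s @` N))) (wings s @` F)) => //.
      apply: (glue _ _ _ _ _ Abot) => //; last by right; exists io.
      by apply: (glue _ _ _ _ _ Btop) => //; exists ta.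
    by rewrite xE !setUA.
  apply: (@two_pieces_crowded _ _ (A `|` (wings s @` N)) (B `|` (wings s @` F))) => //.
  + by apply: (glue _ _ _ _ _ Abot) => //; exists io.
  + by apply: (glue _ _ _ _ _ Btop) => //; exists ta.
  + by rewrite xE setUACA.
have Nta : N ta.
  have [//|/FE] := tipNF ta (or_intror erefl).
  rewrite -(FE _ Fio) angle_bottom angle_top => /site_inj /esym.
  by move=> E; case: (@spq _ _ W).
apply: (@two_pieces_crowded _ _ (A `|` (wings s @` F)) (B `|` (wings s @` N))) => //.
- by apply: (glue _ _ _ _ _ Abot) => //; exists io.
- by apply: (glue _ _ _ _ _ Btop) => //; exists ta.
- by rewrite xE (setUC (wings s @` N)) setUACA.
Qed.

Theorem winged_circle_airplane : locally_connected T -> airplane R T.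
Proof.
move=> lcT; split.
- by split=> //; exact: (@winged_metrizable R T W compactT).
- exact: cut_circle_dense.
- exact: circles_separated.
- move=> A B /(@circleP R T W compactT _)[s ->] /(@circleP R T W compactT _)[t ->] st.
  by apply: rims_disjoint => E; apply: st; rewrite E.
move=> x; apply: crowded_order_two.
have [[s rx]|nrx] := pselect (exists s, rims s x); first exact: on_circle_crowded rx.
by apply: off_circles_crowded => s rx; apply: nrx; exists s.
Qed.
End WingedAirplane.

Local Close Scope ring_scope.
Local Close Scope classical_set_scope.

(** * Streams of letters *)

Section Streams.

Inductive lett := b1 | b2 | b3 | b4 | r1 | r2 | r3.

(** The colour of the replacement graph in which the edge [a] lies. *)
Definition dom (a : lett) : bool :=
  match a with b1 | b2 | b3 | b4 => blue | _ => red end.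

Definition col (a : lett) : bool :=
  match a with b1 | b4 | r3 => blue | _ => red end.

Definition stream := nat -> lett.
Implicit Types (u v : seq lett) (w x y : stream) (a b : lett) (c : bool).

Definition consw a w : stream := fun n => if n is n'.+1 then w n' else a.
Fixpoint catw u w : stream := if u is a :: u' then consw a (catw u' w) else w.
Definition dropw n w : stream := fun k => w (n + k).
Definition tailw := dropw 1.

Lemma stream_eta w : w = consw (w 0) (tailw w).
Proof. by apply: funext => -[|n]. Qed.

Lemma catw_cat u v w : catw (u ++ v) w = catw u (catw v w).
Proof. by elim: u => //= a u ->. Qed.

Lemma catw_rcons u a w : catw (rcons u a) w = catw u (consw a w).
Proof. by rewrite -cats1 catw_cat. Qed.

Lemma catwK u w : dropw (size u) (catw u w) = w.
Proof. by elim: u. Qed.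

Lemma mkseqSl x n : mkseq x n.+1 = x 0 :: mkseq (tailw x) n.
Proof. by rewrite /mkseq /= -[iota 1 n]/(iota (1 + 0) n) iotaDl -map_comp. Qed.

Lemma catw_take u w n : n <= size u -> mkseq (catw u w) n = take n u.
Proof.
elim: u n => [|a u IH] [|n] //= nu.
by rewrite mkseqSl -(IH n nu).
Qed.

Lemma catw_prefix u w : mkseq (catw u w) (size u) = u.
Proof. by rewrite catw_take // take_size. Qed.

Lemma catw_mkseq n w : catw (mkseq w n) (dropw n w) = w.
Proof.
elim: n w => // n IH w; rewrite mkseqSl [RHS]stream_eta /=; congr consw.
exact: IH.
Qed.

Lemma mkseq_catw u w k : mkseq (catw u w) (size u + k) = u ++ mkseq w k.
Proof. by elim: u => //= a u IH; rewrite addSn mkseqSl -IH. Qed.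

Lemma catw_nth u w i : (i < size u)%N -> catw u w i = nth b1 u i.
Proof. by elim: u i => //= a u IH [|i] //=; exact: IH. Qed.

Lemma mkseq_eqP x y n : (forall i, (i < n)%N -> x i = y i) <-> mkseq x n = mkseq y n.
Proof.
split=> [xy|xy i ni]; first by apply/eq_in_map => i; rewrite mem_iota /= => /xy.
by rewrite -(nth_mkseq b1 x ni) -(nth_mkseq b1 y ni) xy.
Qed.

Lemma mkseq_eq_le x y m n : (m <= n)%N -> mkseq x n = mkseq y n ->
  mkseq x m = mkseq y m.
Proof.
by move=> mn /mkseq_eqP xy; apply/mkseq_eqP => i im; apply: xy; exact: leq_trans mn.
Qed.

Lemma stream_split x y : x <> y ->
  exists u a b x' y', [/\ x = catw u (consw a x'), y = catw u (consw b y') & a <> b].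
Proof.
move=> xy; have /boolp.existsNP[n nxy] : ~ forall n, x n = y n.
  by move=> E; apply: xy; exact: funext.
elim: n x y xy nxy => [|n IH] x y xy nxy.
  by exists [::], (x 0), (y 0), (tailw x), (tailw y); split=> //; exact: stream_eta.
have [x0y0|x0y0] := pselect (x 0 = y 0); last first.
  by exists [::], (x 0), (y 0), (tailw x), (tailw y); split=> //; exact: stream_eta.
have [|//|u [a [b [x' [y' [xE yE ab]]]]]] := IH (tailw x) (tailw y).
  by move=> E; apply: nxy; exact: (congr1 (fun w => w n) E).
exists (x 0 :: u), a, b, x', y'; split=> //; last rewrite x0y0;
  by rewrite [LHS]stream_eta ?xE ?yE.
Qed.

(** ** Words that follow the colours *)

Definition valid c w := dom (w 0) = c /\ forall n, dom (w n.+1) = col (w n).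

Fixpoint okpath c u := if u is a :: u' then (dom a == c) && okpath (col a) u' else true.
Fixpoint endcol c u := if u is a :: u' then endcol (col a) u' else c.

Lemma valid_cons c a w : valid c (consw a w) <-> dom a = c /\ valid (col a) w.
Proof.
split=> [[d0 dS]|[ac [d0 dS]]].
  by split=> //; split=> [|n]; [exact: (dS 0)|exact: (dS n.+1)].
by split=> // -[|n]; [exact: d0|exact: dS].
Qed.

Lemma valid_cat c u w : valid c (catw u w) <-> okpath c u /\ valid (endcol c u) w.
Proof.
elim: u c => [|a u IH] c /=; first by split=> // -[].
rewrite valid_cons IH; split=> [[-> [-> ?]]|[/andP[/eqP<- ->] ?]] //.
by rewrite eqxx.
Qed.

(** ** Vertices *)

(** The vertices of a replacement graph: the initial and terminal vertices
    [vi] and [vt], the vertices [vp] and [vq] of the blue graph, and the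
    vertices [vm] and [ve] of the red graph. *)
Inductive vlab := vi | vt | vp | vq | vm | ve.

Definition lab a (s : bool) : vlab :=
  match a, s with
  | b1, false => vp | b1, true => vi
  | b2, false => vq | b2, true => vp
  | b3, false => vp | b3, true => vq
  | b4, false => vq | b4, true => vt
  | r1, false => vi | r1, true => vm
  | r2, false => vm | r2, true => vt
  | r3, false => vm | r3, true => ve
  end.

(** [ve] lies on a single edge. *)
Definition inner_lab l := match l with vp | vq | vm => true | _ => false end.

(** The word, inside an edge of colour [c], of its initial ([s = false]) or
    terminal ([s = true]) vertex. *)
Definition endw c (s : bool) : stream :=
  match c, s with
  | true, false => consw b1 (fun=> b4)
  | true, true => fun=> b4
  | false, false => fun=> r1
  | false, true => fun=> r2
  end.

Definition tip_lab (s : bool) := if s then vt else vi.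

(** The letter of colour [c] that follows the vertex at the end [s], and the end
    of this letter at which the vertex lies. *)
Definition next_end c (s : bool) : lett * bool :=
  match c, s with
  | true, false => (b1, true)
  | true, true => (b4, true)
  | false, false => (r1, false)
  | false, true => (r2, true)
  end.

Lemma endwE c s :
  endw c s = consw (next_end c s).1 (endw (col (next_end c s).1) (next_end c s).2).
Proof. by case: c s => [] []; apply: funext => -[|[|n]]. Qed.

Lemma lab_next_end c s : lab (next_end c s).1 (next_end c s).2 = tip_lab s.
Proof. by case: c s => [] []. Qed.

(** In both replacement graphs the two distinguished vertices have degree 1. *)
Lemma lab_tip a c s s' : dom a = c -> lab a s' = tip_lab s ->
  (a, s') = next_end c s.
Proof. by move=> <-; case: a s s' => [] [] []. Qed.

Lemma endw_valid c s : valid c (endw c s).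
Proof. by case: c s => [] []; split=> // -[|n]. Qed.

(** The two words represent the same vertex, born in the expansion of the edge
    named by their common prefix. *)
Definition mates x y := exists u a s b s',
  [/\ lab a s = lab b s', inner_lab (lab a s),
      x = catw u (consw a (endw (col a) s)) & y = catw u (consw b (endw (col b) s'))].

Definition glue x y := x = y \/ mates x y.

Lemma glue_refl x : glue x x. Proof. by left. Qed.

Lemma glue_catw u x y : glue x y -> glue (catw u x) (catw u y).
Proof.
case=> [->|[v [a [s [b [s' [? ? -> ->]]]]]]]; [by left|right].
by exists (u ++ v), a, s, b, s'; rewrite !catw_cat.
Qed.

Lemma glue_sym x y : glue x y -> glue y x.
Proof.
case=> [->|[v [a [s [b [s' [ab ia -> ->]]]]]]]; [by left|right].
by exists v, b, s', a, s; rewrite -ab.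
Qed.

(** ** Sites of the circle of an airplane *)

(** A site is the end [p] or [q] of the circle, or a dyadic point of its lower
    or upper half, written in binary. *)
Definition wsite := (bool + bool * seq bool)%type.

Definition half s := if s then b3 else b2.
Definition bit s := if s then r2 else r1.

(** The name of the edge attached to the circle at the site [d]. *)
Definition wd (d : wsite) : seq lett :=
  match d with
  | inl s => [:: if s then b4 else b1]
  | inr (s, u) => half s :: rcons (map bit u) r3
  end.

Lemma okpath_bits (u : seq bool) : okpath red (rcons (map bit u) r3) && endcol red (rcons (map bit u) r3).
Proof. by elim: u => //= -[]. Qed.

Lemma okpath_wd d : okpath true (wd d).
Proof. by case: d => [[]|[[] u]] //=; case/andP: (okpath_bits u). Qed.

Lemma endcol_wd d : endcol true (wd d) = true.
Proof. by case: d => [[]|[[] u]] //=; case/andP: (okpath_bits u). Qed.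

Lemma valid_wd d w : valid true (catw (wd d) w) <-> valid true w.
Proof. by rewrite valid_cat okpath_wd endcol_wd; split=> // -[]. Qed.

Definition on_wing d w := mkseq w (size (wd d)) = wd d.

Definition unw d w : stream :=
  if `[< on_wing d w >] then dropw (size (wd d)) w else endw true false.

Lemma unw_wd d w : unw d (catw (wd d) w) = w.
Proof. by rewrite /unw asboolT ?catwK // /on_wing catw_prefix. Qed.

Lemma on_wingE d w : on_wing d w -> w = catw (wd d) (unw d w).
Proof. by move=> dw; rewrite /unw asboolT // -{1}dw catw_mkseq. Qed.

Lemma unw_out d w : ~ on_wing d w -> unw d w = endw true false.
Proof. by move=> dw; rewrite /unw asboolF. Qed.

Lemma unw_valid d w : valid true w -> valid true (unw d w).
Proof.
move=> vw; have [dw|/unw_out ->] := pselect (on_wing d w); last exact: endw_valid.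
by apply/(valid_wd d); rewrite -on_wingE.
Qed.

Lemma endw_no_r3 c s n : endw c s n <> r3.
Proof. by case: c s n => [] [] [|n]. Qed.

(** A vertex created outside the wing can lie in it only as its bottom: at a dyadic
    site, the letters after [a] are not [r3], so that [a] is the last letter of
    the name of the wing. *)
Lemma vertex_on_wing d w u a s : inner_lab (lab a s) -> (size u < size (wd d))%N ->
  catw (wd d) w = catw u (consw a (endw (col a) s)) -> w = endw true false.
Proof.
case: d => [t|[t v]] ia.
  case: u => // _ /= E; have aE : (if t then b4 else b1) = a by exact: (congr1 (@^~ 0%N) E).
  have -> : w = endw (col a) s by have := congr1 tailw E.
  by clear E; subst a; case: t s ia => [] [].
set N := size (wd (inr (t, v))) => uN E.
have wN : catw (wd (inr (t, v))) w N.-1 = r3.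
  by rewrite catw_nth // /N nth_last /= last_rcons.
have NE : N = (size (v)).+2 by rewrite /N /= size_rcons size_map.
have uE : size u = N.-1.
  apply/eqP; rewrite eqn_leq -ltnS NE -NE uN /= leqNgt; apply/negP => lt.
  have := congr1 (dropw (size u)) E; rewrite catwK => /(congr1 (fun w => w (N.-1 - size u))).
  rewrite {1}/dropw subnKC 1?ltnW // wN.
  case: (N.-1 - size u)%N (subn_gt0 (size u) N.-1) => [|k _ /esym]; first by rewrite lt.
  exact: endw_no_r3.
have aE : a = r3.
  rewrite -wN E -uE.
  by have := congr1 (fun w => w 0) (catwK u (consw a (endw (col a) s))); rewrite /dropw addn0.
have Nua : N = size (rcons u a) by rewrite size_rcons uE NE.
have -> : w = endw (col a) s.
  have := congr1 (dropw N) E; rewrite catwK => ->.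
  by rewrite Nua -catw_rcons catwK.
by clear E; subst a; case: s ia.
Qed.

(** If the expansion that creates the common vertex is not in the wing, both words
    are sent to the bottom: the only vertex that such words reach in the wing is
    the one by which it is attached. *)
Lemma unw_mates d x y : mates x y -> glue (unw d x) (unw d y).
Proof.
case=> u [a [s [b [s' [ab ia xE yE]]]]].
have [ud|du] := ltnP (size u) (size (wd d)).
  have end_unw x' a' t : inner_lab (lab a' t) -> x' = catw u (consw a' (endw (col a') t)) ->
      unw d x' = endw true false.
    move=> ia' x'E; have [dx|] := pselect (on_wing d x'); last exact: unw_out.
    by apply: vertex_on_wing ia' ud _; rewrite -on_wingE.
  by rewrite (end_unw _ _ _ ia xE) (end_unw y b s') -?ab //; exact: glue_refl.
have take_u w : on_wing d (catw u w) <-> take (size (wd d)) u = wd d.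
  by rewrite /on_wing catw_take.
have [dx|dx] := pselect (take (size (wd d)) u = wd d); last first.
  by rewrite !unw_out ?xE ?yE ?take_u //; exact: glue_refl.
have dE w : unw d (catw u w) = catw (drop (size (wd d)) u) w.
  by rewrite -{1}(cat_take_drop (size (wd d)) u) dx catw_cat unw_wd.
rewrite xE yE !dE; right.
by exists (drop (size (wd d)) u), a, s, b, s'.
Qed.

Lemma unw_glue d x y : glue x y -> glue (unw d x) (unw d y).
Proof. by case=> [->|/unw_mates]; [exact: glue_refl|exact]. Qed.

Lemma red_wordP w : valid red w ->
  (exists u : seq bool, mkseq w (size u).+1 = rcons (map bit u) r3) \/
  (exists f, w = bit \o f).
Proof.
move=> vw; have [[n wn]|nr3] := pselect (exists n, w n = r3).
  left; elim: n w vw wn => [|n IH] w [w0 wS] wn; first by exists [::]; rewrite /mkseq /= wn.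
  have [w03|w03] := pselect (w 0 = r3); first by exists [::]; rewrite /mkseq /= w03.
  have vt : valid red (tailw w).
    by split=> [|k]; rewrite /tailw /dropw ?wS //; move: w0 w03; case: (w 0).
  have [u uE] := IH _ vt wn; exists ((if w 0 is r2 then true else false) :: u).
  by rewrite mkseqSl uE /=; congr cons; move: w0 w03; case: (w 0).
right; exists (fun n => if w n is r2 then true else false).
have dw n : dom (w n) = red.
  elim: n => [|n IH]; first by case: vw.
  have wn : w n <> r3 by move=> wn; apply: nr3; exists n.
  by have [_ ->] := vw; move: IH wn; case: (w n).
apply: funext => n /=; have wn : w n <> r3 by move=> wn; apply: nr3; exists n.
by move: (dw n) wn; case: (w n).
Qed.

(** A word either enters a wing of the circle or stays on the circle. *)
Lemma blue_wordP w : valid true w ->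
  (exists d, on_wing d w) \/ exists s f, w = consw (half s) (bit \o f).
Proof.
move=> vw; have w0 : dom (w 0) = true by case: vw.
have red_case s : w 0 = half s ->
    (exists d, on_wing d w) \/ exists s f, w = consw (half s) (bit \o f).
  move=> ws; have vt : valid red (tailw w).
    have : valid true (consw (w 0) (tailw w)) by rewrite -stream_eta.
    by rewrite valid_cons ws => -[_]; case: s {ws}.
  have [[u uE]|[f fE]] := red_wordP vt.
    left; exists (inr (s, u)); rewrite /on_wing /= size_rcons size_map.
    by rewrite mkseqSl uE ws.
  by right; exists s, f; rewrite (stream_eta w) ws fE.
case w0E : (w 0) w0 => // _.
- by left; exists (inl false); rewrite /on_wing /mkseq /= w0E.
- exact: (red_case false).
- exact: (red_case true).
- by left; exists (inl true); rewrite /on_wing /mkseq /= w0E.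
Qed.

Lemma rim_word_off s f d : ~ on_wing d (consw (half s) (bit \o f)).
Proof.
case: d => [t|[t u]]; first by case: t s => [] [] [].
rewrite /on_wing /= size_rcons size_map mkseqSl => -[_ E].
have := congr1 (last r3) E; rewrite last_rcons mkseqS last_rcons /tailw /dropw /=.
by case: (f _).
Qed.

Lemma rim_word_valid s f : valid true (consw (half s) (bit \o f)).
Proof.
apply/valid_cons; split; first by case: s.
have -> : col (half s) = red by case: s.
by split=> [|n] /=; [case: (f _)|case: (f n.+1); case: (f n)].
Qed.

Lemma unw_rim s f d : unw d (consw (half s) (bit \o f)) = endw true false.
Proof. exact: unw_out (@rim_word_off s f d). Qed.
End Streams.

(** * Streams and the symbol space *)

Section SymbolSpace.

Import GluingTheory.


Local Notation AS := airplane_system.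
Implicit Types (u v : seq lett) (w x y : stream) (a b : lett) (c : bool).

Definition enc a : letter AS :=
  match a with
  | b1 => @rlet AS true (@Ordinal 4 0 isT)
  | b2 => @rlet AS true (@Ordinal 4 1 isT)
  | b3 => @rlet AS true (@Ordinal 4 2 isT)
  | b4 => @rlet AS true (@Ordinal 4 3 isT)
  | r1 => @rlet AS false (@Ordinal 3 0 isT)
  | r2 => @rlet AS false (@Ordinal 3 1 isT)
  | r3 => @rlet AS false (@Ordinal 3 2 isT)
  end.

Definition dec (l : letter AS) : lett :=
  match l with
  | inl _ => b1
  | inr (existT c r) =>
      (match c return edge (airplane_repl c) -> lett with
       | true => fun r : 'I_4 => nth b1 [:: b1; b2; b3; b4] r
       | false => fun r : 'I_3 => nth r1 [:: r1; r2; r3] r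
       end) r
  end.

Lemma encK : cancel enc dec.
Proof. by case. Qed.

Lemma decK c (r : edge (airplane_repl c)) : enc (dec (@rlet AS c r)) = @rlet AS c r.
Proof.
by case: c r => [] [[|[|[|[|//]]]] ?]; rewrite /rlet /=; congr (inr (existT _ _ _));
  apply: val_inj.
Qed.

Definition root_letter : letter AS := inl (@Ordinal 1 0 isT).

Lemma follows_root a : @follows AS root_letter (enc a) = dom a.
Proof. by case: a. Qed.

Lemma follows_enc a b : @follows AS (enc a) (enc b) = (dom b == col a).
Proof. by case: a b => [] []. Qed.

Lemma lcol_enc a : lcol (enc a) = col a.
Proof. by case: a. Qed.

Definition spell u : seq (letter AS) := root_letter :: map enc u.

Lemma spell_rcons u a : spell (rcons u a) = rcons (spell u) (enc a).
Proof. by rewrite /spell map_rcons. Qed.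

Lemma spell_inj : injective spell.
Proof. by move=> u v [/(inj_map (can_inj encK))]. Qed.

Definition word_of w : iword AS := fun n => if n is n'.+1 then enc (w n') else root_letter.

Lemma word_of_prefix w k : prefix_word (word_of w) k.+1 = spell (mkseq w k).
Proof.
rewrite /prefix_word /spell /mkseq /= -[iota 1 k]/(iota (1 + 0) k) iotaDl.
by rewrite -!map_comp.
Qed.

(** Expanding the edges named by the prefixes of [w] one after the other. *)
Lemma spell_expansion w n : valid true w ->
  exists2 G : named_graph AS, graph_expansion G &
    exists2 e : edge G, name e = spell (mkseq w n) & ecol e = dom (w n).
Proof.
move=> [w0 wS]; elim: n => [|n [G GE [e eE ec]]].
  by exists (base_graph AS); [exact: expansion_base|exists (@Ordinal 1 0 isT)].
exists (Defs.expand e); first exact: expansion_step.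
have [r rE] : exists r : edge (@repl AS (ecol e)), rlet r = enc (w n).
  rewrite ec; case: (w n) => /=.
  - by exists (@Ordinal 4 0 isT).
  - by exists (@Ordinal 4 1 isT).
  - by exists (@Ordinal 4 2 isT).
  - by exists (@Ordinal 4 3 isT).
  - by exists (@Ordinal 3 0 isT).
  - by exists (@Ordinal 3 1 isT).
  - by exists (@Ordinal 3 2 isT).
exists (inr r) => /=.
  by rewrite -[inr _]/(rlet r) rE eE -spell_rcons mkseqS.
by rewrite wS -lcol_enc -rE.
Qed.

Lemma word_of_symbol w : valid true w -> symbol_space AS (word_of w).
Proof.
move=> vw [//|k] _; have [G GE [e eE _]] := spell_expansion k vw.
by exists G => //; exists e; rewrite eE word_of_prefix.
Qed.

Lemma symbol_word (x : iword AS) : symbol_space AS x ->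
  exists2 w, valid true w & x = word_of w.
Proof.
move=> sx; have fol k : path (@follows AS) (x 0) (mkseq (fun i => x i.+1) k) /\ x 0 = root_letter.
  have [G /wf_expansion[wfG _ _] [e eE]] := sx k.+1 isT.
  have [b [s [es ps _]]] := wfG e.
  move: eE; rewrite es /prefix_word /mkseq /= -[iota 1 k]/(iota (1 + 0) k) iotaDl -map_comp.
  case=> bx sE; split; first by rewrite -bx; move: ps; rewrite sE.
  by rewrite -bx; congr inl; apply: val_inj; case: (b) => -[].
have x0 := (fol 0).2.
have fx k : @follows AS (x k) (x k.+1).
  have [/(pathP root_letter) /(_ k) + _] := fol k.+1.
  rewrite size_mkseq ltnSn => /(_ isT); rewrite nth_mkseq //.
  by case: k => [//|k]; rewrite /= nth_mkseq // ltnW.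
have xS k : enc (dec (x k.+1)) = x k.+1.
  by move: (fx k); rewrite /follows; case: (x k.+1) => // -[c r] _; exact: decK.
have xE : x = word_of (fun n => dec (x n.+1)).
  by apply: boolp.funext => -[|n] /=.
exists (fun n => dec (x n.+1)) => //; split=> [|n].
  by rewrite -follows_root xS -x0; exact: fx.
by apply/eqP; rewrite -follows_enc !xS; exact: fx.
Qed.

(** ** The ends of an edge *)

Definition ends u := rends (rev (spell u)).

Definition vertex_of u l : vname AS :=
  match l with
  | vi => (ends u).1
  | vt => (ends u).2
  | vp => @fresh AS (spell u) true (@Ordinal 4 1 isT)
  | vq => @fresh AS (spell u) true (@Ordinal 4 2 isT)
  | vm => @fresh AS (spell u) false (@Ordinal 4 1 isT)
  | ve => @fresh AS (spell u) false (@Ordinal 4 3 isT)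
  end.

Lemma ends_rcons u a :
  ends (rcons u a) = (vertex_of u (lab a false), vertex_of u (lab a true)).
Proof. by rewrite /ends spell_rcons rev_rcons; case: a; rewrite /= revK. Qed.

Lemma vends_spell u : vends (spell u) = [:: vertex_of u vi; vertex_of u vt].
Proof. by []. Qed.

Lemma vends_spell_rcons u a :
  vends (spell (rcons u a)) = [:: vertex_of u (lab a false); vertex_of u (lab a true)].
Proof. by rewrite /vends -/(ends (rcons u a)) ends_rcons. Qed.

Lemma vertex_of_fresh u c (i : vert (@repl AS c)) s :
  vertex_of u (tip_lab s) <> fresh (spell u) i.
Proof.
move=> E; have := fresh_notin (spell u) i; rewrite -E vends_spell.
by case: s {E}; rewrite !inE eqxx ?orbT.
Qed.

Lemma fresh_inj u c (i j : vert (@repl AS c)) :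
  fresh (spell u) i = fresh (spell u) j -> i = j.
Proof. by case=> /eqP; rewrite eq_Tagged => /eqP. Qed.

Lemma vertex_of_inj u : injective (vertex_of u).
Proof.
have tips : (ends u).1 <> (ends u).2.
  elim/last_ind: u => [//|u a IH]; rewrite ends_rcons /=.
  have nf c i s : vertex_of u (tip_lab s) <> @fresh AS (spell u) c i by exact: vertex_of_fresh.
  case: a => //=; try (by move=> /fresh_inj); try exact: (nf _ _ false);
    try exact: (nf _ _ true); try exact: nesym (nf _ _ false);
    exact: nesym (nf _ _ true).
have nf c i s : vertex_of u (tip_lab s) <> @fresh AS (spell u) c i by exact: vertex_of_fresh.
have f0 c i := nf c i false; have f1 c i := nf c i true.
case=> [] [] //=; try (by move=> /tips); try (by move=> /esym/tips);
  try (by move=> /f0); try (by move=> /f1); try (by move=> /esym/f0);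
  try (by move=> /esym/f1); by [move=> /fresh_inj|case].
Qed.

Lemma vertex_rcons u a s : vertex_of (rcons u a) (tip_lab s) = vertex_of u (lab a s).
Proof. by rewrite [LHS]/vertex_of; case: s; rewrite /= ends_rcons. Qed.

(** ** Gluing *)

Lemma endw_vertex u c s k :
  vertex_of u (tip_lab s) \in vends (spell (u ++ mkseq (endw c s) k)).
Proof.
elim: k u c s => [|k IH] u c s.
  by rewrite cats0 vends_spell !inE; case: s; rewrite /= eqxx ?orbT.
rewrite endwE mkseqSl; set a := (next_end c s).1; set t := (next_end c s).2.
rewrite -cat_rcons -(lab_next_end c s) -/a -/t.
by rewrite -vertex_rcons; exact: IH.
Qed.

Lemma mates_gluing w w' (x y : symbol_space AS) :
  set_val x = word_of w -> set_val y = word_of w' -> mates w w' -> gluing x y.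
Proof.
move=> xE yE [u [a [s [b [s' [ab ia wE w'E]]]]]].
apply/gluingP; exists (size u).+2 => k; case: k => // k; rewrite ltnS => uk.
rewrite xE yE !word_of_prefix.
have split_k a' t : mkseq (catw u (consw a' (endw (col a') t))) k =
    rcons u a' ++ mkseq (endw (col a') t) (k - (size u).+1).
  by rewrite -catw_rcons -{1}(subnKC uk) -(size_rcons u a') mkseq_catw.
exists (vertex_of u (lab a s)); rewrite wE w'E !split_k.
by split; [rewrite -vertex_rcons|rewrite ab -vertex_rcons]; exact: endw_vertex.
Qed.

Lemma vends_rcons_lab u a z : z \in vends (spell (rcons u a)) ->
  exists s, z = vertex_of u (lab a s).
Proof.
by rewrite vends_spell_rcons !inE => /orP[] /eqP ->; [exists false|exists true].
Qed.

(** An end of an edge lies on a single edge of its expansion ([lab_tip]), so that a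
    word that keeps this vertex has no choice. *)
Lemma vertex_forces u c w s : valid c w ->
  (forall k, vertex_of u (tip_lab s) \in vends (spell (u ++ mkseq w k))) ->
  w = endw c s.
Proof.
move=> vw inz; apply: boolp.funext => n.
elim: n u c w s vw inz => [|n IH] u c w s vw inz;
  have := inz 1; rewrite /mkseq /= cats1 => /vends_rcons_lab[t /vertex_of_inj tE];
  have [w0 _] := vw; have w0E := lab_tip w0 (esym tE);
  rewrite endwE -w0E //=.
apply: (IH (rcons u (w 0)) (col (w 0)) (tailw w) t).
  have : valid c (consw (w 0) (tailw w)) by rewrite -stream_eta.
  by case/valid_cons.
by move=> k; rewrite vertex_rcons -tE cat_rcons -mkseqSl.
Qed.

Lemma no_bridge (c : color AS) (r : edge (@repl AS c)) :
  ~~ ((ini c \in [:: src r; tgt r]) && (ter c \in [:: src r; tgt r])).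
Proof. by case: c r => [] [[|[|[|[|//]]]] ?]. Qed.

(** Glued words have a common vertex at all large depths, which by descent is
    present just after they split; from there on both words are forced to follow
    this vertex. *)
Lemma gluing_mates w w' (x y : symbol_space AS) : valid true w -> valid true w' ->
  set_val x = word_of w -> set_val y = word_of w' -> w <> w' -> gluing x y ->
  mates w w'.
Proof.
move=> vw vw' xE yE ww' gxy.
have [u [a [b [x' [y' [wE w'E ab]]]]]] := stream_split ww'.
have xy : x <> y.
  move=> E; apply: ww'; apply: boolp.funext => n.
  apply: (can_inj encK); have : word_of w = word_of w' by rewrite -xE -yE E.
  by move=> /(congr1 (fun f : nat -> letter AS => f n.+1)).
have [z [N Nz]] := gluing_vertex no_bridge xy gxy.
have inz k : (size u < k)%N ->
    z \in vends (spell (mkseq w k)) /\ z \in vends (spell (mkseq w' k)).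
  move=> uk; have [m] := ubnP (N - k); elim: m k uk => // m IH k uk Nk.
  have [Nk'|kN] := leqP N k.
    by have := Nz k.+1 (leqW Nk'); rewrite xE yE !word_of_prefix.
  have [|zw zw'] := IH k.+1 (ltnW uk).
    by rewrite -ltnS (leq_trans _ Nk) // ltnS ltn_sub2l.
  case: k uk Nk kN zw zw' => // k uk Nk kN zw zw'.
  rewrite -!word_of_prefix; apply: touching_descend => //.
  - by rewrite -xE; exact: symbol_val.
  - by rewrite -yE; exact: symbol_val.
  - apply/eqP; rewrite !word_of_prefix => /spell_inj /mkseq_eqP /(_ _ uk).
    rewrite wE w'E -!catw_rcons !catw_nth ?size_rcons // !nth_rcons ltnn eqxx.
    exact: ab.
  - by rewrite word_of_prefix.
  - by rewrite word_of_prefix.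
have wk e (v' : stream) k : mkseq (catw u (consw e v')) (size (rcons u e) + k) =
    rcons u e ++ mkseq v' k by rewrite -catw_rcons mkseq_catw.
have inza k : z \in vends (spell (rcons u a ++ mkseq x' k)).
  by rewrite -wk -wE; case: (inz (size (rcons u a) + k)) => //; rewrite size_rcons ltnS leq_addr.
have inzb k : z \in vends (spell (rcons u b ++ mkseq y' k)).
  by rewrite -wk -w'E; case: (inz (size (rcons u b) + k)) => //; rewrite size_rcons ltnS leq_addr.
have [s zs] : exists s, z = vertex_of u (lab a s).
  by apply: vends_rcons_lab; have := inza 0; rewrite cats0.
have [s' zs'] : exists s, z = vertex_of u (lab b s).
  by apply: vends_rcons_lab; have := inzb 0; rewrite cats0.
move: vw vw'; rewrite wE w'E => /valid_cat[_ /valid_cons[da vx']] /valid_cat[_ /valid_cons[db vy']].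
have labE : lab a s = lab b s' by apply: (@vertex_of_inj u); rewrite -zs -zs'.
exists u, a, s, b, s'; split=> //.
- by move: da labE ab; rewrite -db; case: a b s s' {wE w'E wk inz inza inzb zs zs' vx' vy' db} => [] [] [] [].
- by rewrite (vertex_forces vx' (s := s) (u := rcons u a)) // => k; rewrite vertex_rcons -zs.
- by rewrite (vertex_forces vy' (s := s') (u := rcons u b)) // => k; rewrite vertex_rcons -zs'.
Qed.
End SymbolSpace.

Local Open Scope classical_set_scope.
Local Open Scope ring_scope.

(** * Angles *)

Section Angles.
Context (R : realType).
Implicit Types (u v : seq lett) (w x y : stream) (a b : lett) (c : bool).
Implicit Types (t : R) (s : bool) (d e : wsite).

(** The letters [r1] and [r2] are the binary digits 0 and 1, and [t] is the value
    of the rest of the word; [r3] leaves the half circle at the midpoint of the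
    current dyadic interval. *)
Definition digit a t : R :=
  match a with r1 => t / 2 | r2 => (1 + t) / 2 | _ => 1 / 2 end.

Fixpoint hn n w : R := if n is n'.+1 then digit (w 0%N) (hn n' (tailw w)) else 0.

Lemma digit_le a t t' : t <= t' -> digit a t <= digit a t'.
Proof. by case: a => /=; lra. Qed.

Lemma digit_itv a t : 0 <= t <= 1 -> 0 <= digit a t <= 1.
Proof. by move=> /andP[t0 t1]; apply/andP; split; case: a => /=; lra. Qed.

Lemma hn_itv n w : 0 <= hn n w <= 1.
Proof. by elim: n w => [|n IH] w /=; [rewrite lexx ler01|exact: digit_itv]. Qed.

Lemma hn_nondecreasing w : nondecreasing_seq (hn^~ w).
Proof.
apply/nondecreasing_seqP => n; elim: n w => [|n IH] w.
  by case/andP: (hn_itv 1 w).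
exact: digit_le (IH (tailw w)).
Qed.

Lemma hn_cvg w : cvgn (hn^~ w).
Proof.
apply: nondecreasing_is_cvgn; first exact: hn_nondecreasing.
by exists 1 => _ [n _ <-]; case/andP: (hn_itv n w).
Qed.

Definition h w : R := limn (hn^~ w).

Lemma hE w : h w = digit (w 0%N) (h (tailw w)).
Proof.
apply: cvg_lim => //; rewrite -cvg_shiftS /=.
have cv : hn^~ (tailw w) @ \oo --> h (tailw w) by exact: hn_cvg.
case: (w 0%N) => /=; try exact: cvg_cst.
- by apply: cvgM => //; exact: cvg_cst.
- by apply: cvgM; [apply: cvgD => //|]; exact: cvg_cst.
Qed.

Lemma h_consw a w : h (consw a w) = digit a (h w).
Proof. exact: hE. Qed.

Lemma h_itv w : 0 <= h w <= 1.
Proof.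
by apply/andP; split; [apply: limr_ge|apply: limr_le]; try exact: hn_cvg;
  apply: nearW => n; case/andP: (hn_itv n w).
Qed.

Lemma digit_dist a t t' : `|digit a t - digit a t'| <= `|t - t'| / 2.
Proof.
case: a => /=; rewrite ?subrr ?normr0 ?divr_ge0 //.
- by rewrite -mulrBl normrM (ger0_norm (x := 2^-1)) // invr_ge0.
- have -> : (1 + t) / 2 - (1 + t') / 2 = (t - t') / 2 by lra.
  by rewrite normrM (ger0_norm (x := 2^-1)) // invr_ge0.
Qed.

Lemma h_close n x y : (forall i, (i < n)%N -> x i = y i) ->
  `|h x - h y| <= 2^-1 ^+ n.
Proof.
elim: n x y => [|n IH] x y xy.
  have /andP[x0 x1] := h_itv x; have /andP[y0 y1] := h_itv y.
  by rewrite expr0 ler_norml; apply/andP; split; lra.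
rewrite (hE x) (hE y) xy // exprS mulrC; apply: le_trans (digit_dist _ _ _) _.
rewrite ler_wpM2r ?invr_ge0 //; apply: IH => i ni; exact: xy.
Qed.

Lemma h_eq0 w : h w = 0 -> w = endw red false.
Proof.
move=> hw; apply: boolp.funext => n; elim: n w hw => [|n IH] w; rewrite hE => hw.
  have /andP[t0 _] := h_itv (tailw w).
  by move: hw; case: (w 0%N) => //= hw; exfalso; lra.
apply: (IH (tailw w)); have /andP[t0 _] := h_itv (tailw w).
by move: hw; case: (w 0%N) => //= hw; lra.
Qed.

Lemma h_eq1 w : h w = 1 -> w = endw red true.
Proof.
move=> hw; apply: boolp.funext => n; elim: n w hw => [|n IH] w; rewrite hE => hw.
  have /andP[_ t1] := h_itv (tailw w).
  by move: hw; case: (w 0%N) => //= hw; exfalso; lra.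
apply: (IH (tailw w)); have /andP[_ t1] := h_itv (tailw w).
by move: hw; case: (w 0%N) => //= hw; lra.
Qed.

Lemma h_r1 : h (endw red false) = 0.
Proof. by have := hE (endw red false); rewrite /= => E; lra. Qed.

Lemma h_r2 : h (endw red true) = 1.
Proof. by have := hE (endw red true); rewrite /= => E; lra. Qed.

Lemma half_pow_small (e : R) : 0 < e -> exists n, 2^-1 ^+ n < e.
Proof.
move=> e0; have := archi_boundP (ltW (divr_gt0 ltr01 e0)).
set m := Num.bound _ => em; exists m.
rewrite exprVn invf_plt ?posrE ?exprn_gt0 // -div1r; apply: lt_trans em _.
by rewrite -natrX ltr_nat ltn_expl.
Qed.

(** The binary digits of [t] along its orbit under the doubling map. *)
Definition bits t : nat -> bool :=
  fun n => 2^-1 <= iter n (fun t => if 2^-1 <= t then 2 * t - 1 else 2 * t) t.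

Lemma h_bits t : 0 <= t <= 1 -> h (bit \o bits t) = t.
Proof.
move=> t01; suff le_n n : `|h (bit \o bits t) - t| <= 2^-1 ^+ n.
  apply/eqP; rewrite -subr_eq0 -normr_le0 leNgt; apply/negP => /half_pow_small[n].
  by rewrite ltNge le_n.
elim: n t t01 => [|n IH] t t01.
  have /andP[x0 x1] := h_itv (bit \o bits t); have /andP[y0 y1] := t01.
  by rewrite expr0 ler_norml; apply/andP; split; lra.
pose t' := if 2^-1 <= t then 2 * t - 1 else 2 * t.
have t'01 : 0 <= t' <= 1.
  by rewrite /t'; case: ifPn; rewrite -?ltNge => ?; apply/andP; split; lra.
have tE : t = digit (bit (2^-1 <= t)) t'.
  by rewrite /t'; case: ifPn => _ /=; lra.
have -> : bit \o bits t = consw (bit (2^-1 <= t)) (bit \o bits t').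
  by apply: boolp.funext => -[|k] //=; rewrite /bits iterSr.
rewrite h_consw {2}tE exprS mulrC; apply: le_trans (digit_dist _ _ _) _.
by rewrite ler_wpM2r ?invr_ge0 //; exact: IH.
Qed.

(** The half circles are parametrized by abscissa, which avoids trigonometry. *)
Definition arc s t : R * R :=
  (2 * t - 1, (if s then 1 else -1) * (2 * Num.sqrt (t * (1 - t)))).

Lemma arc_circle s t : 0 <= t <= 1 -> unit_circle R (arc s t).
Proof.
move=> /andP[t0 t1]; rewrite /unit_circle /arc /= !exprMn sqr_sqrtr; last first.
  by rewrite mulr_ge0 // subr_ge0.
by case: s; rewrite ?sqrrN expr1n; ring.
Qed.

Lemma arc_continuous s : continuous (arc s).
Proof.
move=> t; apply: (@continuous_at_pair R R R).
  by apply: cvgB; [apply: cvgM => //|]; exact: cvg_cst.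
apply: cvgM; first exact: cvg_cst.
apply: cvgM; first exact: cvg_cst.
apply: (@continuous_comp R R R (fun t => t * (1 - t))); last exact: sqrt_continuous.
by apply: cvgM => //; apply: cvgB => //; exact: cvg_cst.
Qed.

Lemma arc_ends s t : t = 0 \/ t = 1 -> arc s t = (2 * t - 1, 0).
Proof. by move=> [->|->]; rewrite /arc ?subrr ?mul0r ?mulr0 sqrtr0 !mulr0. Qed.

Lemma arc_inj s s' t t' : 0 <= t <= 1 -> arc s t = arc s' t' ->
  t = t' /\ [\/ s = s', t = 0 | t = 1].
Proof.
move=> /andP[t0 t1]; rewrite /arc => -[E1 E2]; have tt' : t = t' by lra.
split=> //; rewrite -tt' in E2.
have [->|t0'] := eqVneq t 0; first by constructor 2.
have [->|t1'] := eqVneq t 1; first by constructor 3.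
have : 0 < Num.sqrt (t * (1 - t)).
  by rewrite sqrtr_gt0 mulr_gt0 // ?subr_gt0 lt_neqAle ?t1' // eq_sym t0'.
by move: E2; case: s s' => [] [] E2 r0; (try by constructor 1); exfalso; lra.
Qed.

Definition ang w : R * R :=
  match w 0%N with
  | b1 => (-1, 0)
  | b4 => (1, 0)
  | b3 => arc true (h (tailw w))
  | _ => arc false (1 - h (tailw w))
  end.

(** The red edges [b3] and [b2] run from [p] to [q] and from [q] to [p]. *)
Definition orient s t : R := if s then t else 1 - t.

Lemma orient_itv s t : 0 <= t <= 1 -> 0 <= orient s t <= 1.
Proof. by move=> /andP[t0 t1]; case: s => /=; apply/andP; split; lra. Qed.

Lemma ang_half s w : ang (consw (half s) w) = arc s (orient s (h w)).
Proof. by case: s. Qed.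

Lemma ang_circle w : unit_circle R (ang w).
Proof.
rewrite /ang; case: (w 0%N); try exact: unit_circle_west; try exact: unit_circle_east;
  try exact: (arc_circle true (h_itv _));
  exact: (arc_circle false (orient_itv false (h_itv _))).
Qed.

Lemma ang_onto z : unit_circle R z -> exists s f, ang (consw (half s) (bit \o f)) = z.
Proof.
case: z => x y; rewrite /unit_circle /= => xy.
pose t := (x + 1) / 2; have x2 : x ^+ 2 <= 1 by rewrite -xy lerDl sqr_ge0.
have t01 : 0 <= t <= 1 by rewrite /t; apply/andP; split; nra.
have tt : t * (1 - t) = (y / 2) ^+ 2 by rewrite /t; lra.
exists (0 <= y), (bits (orient (0 <= y) t)).
rewrite ang_half h_bits; last exact: orient_itv.
have -> : orient (0 <= y) (orient (0 <= y) t) = t by case: (0 <= y) => //=; ring.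
rewrite /arc tt sqrtr_sqr; congr (_, _); first by rewrite /t; field.
have [y0|y0] := leP 0 y.
  by rewrite ger0_norm ?divr_ge0 //; field.
by rewrite ltr0_norm ?pmulr_llt0 ?invr_gt0 //; field.
Qed.

Lemma ang_continuous w (U : set (R * R)) : nbhs (ang w) U ->
  exists n, forall w', mkseq w n = mkseq w' n -> U (ang w').
Proof.
move=> Uw.
have arc_near s (f : stream -> R) : (forall n x y, mkseq x n.+1 = mkseq y n.+1 ->
     `|f x - f y| <= 2^-1 ^+ n) -> nbhs (arc s (f w)) U ->
   exists n, forall w', mkseq w n.+1 = mkseq w' n.+1 -> U (arc s (f w')).
  move=> fclose /arc_continuous /nbhs_ballP[e /= e0 eU].
  have [n ne] := half_pow_small e0; exists n => w' ww'; apply: eU.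
  by rewrite /ball /=; apply: le_lt_trans (fclose _ _ _ ww') ne.
have tail_close n x y : mkseq x n.+1 = mkseq y n.+1 -> `|h (tailw x) - h (tailw y)| <= 2^-1 ^+ n.
  by move=> /mkseq_eqP xy; apply: h_close => i ni; exact: xy.
have tail_close' n x y : mkseq x n.+1 = mkseq y n.+1 ->
    `|(1 - h (tailw x)) - (1 - h (tailw y))| <= 2^-1 ^+ n.
  move=> /tail_close; rewrite distrC; congr (_ <= _); congr `|_|; ring.
have same0 w' n : mkseq w n.+1 = mkseq w' n.+1 -> w' 0%N = w 0%N.
  by move=> /mkseq_eqP /(_ 0%N isT).
case w0 : (w 0%N).
1, 4: by exists 1%N => w' /same0 w'0; move: Uw; rewrite /ang w'0 w0; exact: nbhs_singleton.
1, 3, 4, 5: have [|n nU] := arc_near false _ tail_close';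
  [by move: Uw; rewrite /ang w0|exists n.+1 => w' ww'];
  by have := nU _ ww'; rewrite /ang (same0 _ _ ww') w0.
have [|n nU] := arc_near true _ tail_close; first by move: Uw; rewrite /ang w0.
by exists n.+1 => w' ww'; have := nU _ ww'; rewrite /ang (same0 _ _ ww') w0.
Qed.

(** ** Angles and gluing *)

Lemma h_mates x y : valid red x -> valid red y -> mates x y -> h x = h y.
Proof.
move=> vx vy [u [a [s [b [s' [ab ia xE yE]]]]]]; subst x y.
have h_m a' (t : bool) : dom a' = red -> inner_lab (lab a' t) ->
    h (consw a' (endw (col a') t)) = 1 / 2.
  by rewrite h_consw; case: a' t => [] [] //= _ _; rewrite ?h_r1 ?h_r2; lra.
elim: u vx vy => [|e u IH] /valid_cons[de vx] /valid_cons[db vy].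
  by rewrite !h_m // -?ab.
rewrite !h_consw; case: e de vx vy db => //= _ vx vy _; by rewrite IH.
Qed.

Lemma ang_mates x y : valid true x -> valid true y -> mates x y -> ang x = ang y.
Proof.
move=> vx vy [u [a [s [b [s' [ab ia xE yE]]]]]].
have ang_pq a' (t : bool) : dom a' = true -> inner_lab (lab a' t) ->
    ang (consw a' (endw (col a') t)) = (if lab a' t is vp then -1 else 1, 0).
  have hr1 := h_r1; have hr2 := h_r2; rewrite /red in hr1 hr2.
  by case: a' t => [] [] //= _ _; rewrite /ang /= -?[tailw _]/(endw false _) ?hr1 ?hr2
    ?subrr ?subr0 // arc_ends; try (by left); try (by right); congr (_, _); ring.
case: u xE yE => [|e u] xE yE.
  move: vx vy; rewrite xE yE => /valid_cons[da _] /valid_cons[db _].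
  by rewrite !ang_pq // -?ab.
have tails : col e = red -> h (tailw x) = h (tailw y).
  move=> ce; move: vx vy; rewrite xE yE => /valid_cons[_ vx] /valid_cons[_ vy].
  apply: h_mates; [by rewrite -ce|by rewrite -ce|].
  by exists u, a, s, b, s'.
have x0 : x 0%N = e by rewrite xE.
have y0 : y 0%N = e by rewrite yE.
have de : dom e = true by case: vx; rewrite x0.
by rewrite /ang x0 y0; case: e tails de {xE yE x0 y0} => //= /(_ erefl) ->.
Qed.

Lemma ang_glue x y : valid true x -> valid true y -> glue x y -> ang x = ang y.
Proof. by move=> vx vy [->//|]; exact: ang_mates. Qed.

Lemma glue_consw a x y : glue x y -> glue (consw a x) (consw a y).
Proof. exact: (@glue_catw [:: a]). Qed.

(** Red words whose value determines them up to gluing: those that stay on the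
    half circle, and those that represent the bottom of a wing. *)
Definition red_rim x := (exists f, x = bit \o f) \/
  (exists u : seq bool, x = catw (rcons (map bit u) r3) (endw true false)).

Lemma red_rim_consw a x : red_rim (consw a x) ->
  (a = r3 /\ x = endw true false) \/ ((exists s, a = bit s) /\ red_rim x).
Proof.
case=> [[f E]|[[|s u] E]].
- right; split; first by exists (f 0%N); exact: (congr1 (@^~ 0%N) E).
  by left; exists (fun n => f n.+1); exact: (congr1 tailw E).
- by left; split; [exact: (congr1 (@^~ 0%N) E)|exact: (congr1 tailw E)].
- right; split; first by exists s; exact: (congr1 (@^~ 0%N) E).
  by right; exists u; exact: (congr1 tailw E).
Qed.

(** At the first difference the values of the rests are forced to be 0 or 1, so
    that both words run to the middle vertex of a red edge. *)
Lemma h_rim_inj x y : red_rim x -> red_rim y -> h x = h y -> glue x y.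
Proof.
move=> rx ry hxy; have [->|xy] := pselect (x = y); first exact: glue_refl.
have [u [a [b [x' [y' [xE yE ab]]]]]] := stream_split xy; subst x y.
elim: u rx ry hxy {xy} => [|e u IH] rx ry hxy.
  have m_mates a' s' b' s'' : lab a' s' = vm -> lab b' s'' = vm ->
    glue (consw a' (endw (col a') s')) (consw b' (endw (col b') s'')).
    by move=> la lb; right; exists [::], a', s', b', s''; rewrite la lb.
  move: hxy; rewrite /= !h_consw.
  have /andP[x0 x1] := h_itv x'; have /andP[y0 y1] := h_itv y'.
  have m12 := m_mates r1 true r2 false erefl erefl.
  have m21 := m_mates r2 false r1 true erefl erefl.
  have m13 := m_mates r1 true r3 false erefl erefl.
  have m31 := m_mates r3 false r1 true erefl erefl.
  have m23 := m_mates r2 false r3 false erefl erefl.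
  have m32 := m_mates r3 false r2 false erefl erefl.
  case: (red_rim_consw rx) ab => [[-> ->]|[[[] ->] _]] ab;
  case: (red_rim_consw ry) ab => [[-> ->]|[[[] ->] _]] //= ab hxy.
  - by rewrite (@h_eq0 y') //; lra.
  - by rewrite (@h_eq1 y') //; lra.
  - by rewrite (@h_eq0 x') //; lra.
  - rewrite (@h_eq0 x'); last lra.
    by rewrite (@h_eq1 y'); last lra.
  - by rewrite (@h_eq1 x') //; lra.
  - rewrite (@h_eq1 x'); last lra.
    by rewrite (@h_eq0 y'); last lra.
move: hxy; rewrite /= !h_consw => hxy; apply: glue_consw.
have cx := @red_rim_consw e (catw u (consw a x')) rx.
have cy := @red_rim_consw e (catw u (consw b y')) ry.
case: cx hxy => [[eE ->]|[[s eE] rx']] hxy.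
  by case: cy => [[_ ->]|[[[]]]]; [exact: glue_refl|rewrite eE..].
case: cy => [[eE' _]|[_ ry']]; first by rewrite eE in eE'; case: (s) eE'.
by apply: IH => //; move: hxy; rewrite eE; case: (s) => /=; lra.
Qed.

(** The words of the second form represent the sites. *)
Definition circ_word x := (exists s f, x = consw (half s) (bit \o f)) \/
  (exists d, x = catw (wd d) (endw true false)).

Lemma circ_wordP x : circ_word x ->
  (exists s, x = consw (if s then b4 else b1) (endw true false)) \/
  (exists s x', x = consw (half s) x' /\ red_rim x').
Proof.
case=> [[s [f ->]]|[[s|[s u]] ->]].
- by right; exists s, (bit \o f); split=> //; left; exists f.
- by left; exists s.
- by right; exists s; eexists; split; first by []; right; exists u.
Qed.

(** Words with the same angle on both half circles run to [p] or to [q]. *)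
Lemma circ_inj x y : circ_word x -> circ_word y -> ang x = ang y -> glue x y.
Proof.
move=> /circ_wordP cx /circ_wordP cy xy.
have pq_mates l a s b s' : l = vp \/ l = vq -> lab a s = l -> lab b s' = l ->
    glue (consw a (endw (col a) s)) (consw b (endw (col b) s')).
  move=> lpq la lb; right; exists [::], a, s, b, s'.
  by split=> //; rewrite la //; case: lpq => ->.
have end_half s x' : h x' = 0 \/ h x' = 1 -> exists t : bool,
   [/\ x' = endw (col (half s)) t,
      orient s (h x') = (if lab (half s) t is vp then 0 else 1)
    & lab (half s) t = vp \/ lab (half s) t = vq].
  case=> hx'; [exists false; rewrite (h_eq0 hx')|exists true; rewrite (h_eq1 hx')];
   rewrite ?h_r1 ?h_r2; case: s; rewrite /= ?subrr ?subr0; split=> //;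
   by [left|right].
have main_half s x' (t : bool) : ang (consw (half s) x') = ang (consw (if t then b4 else b1) (endw true false)) ->
    glue (consw (half s) x') (consw (if t then b4 else b1) (endw true false)).
  have /andP[x0 x1] := h_itv x'; clear cx cy xy.
  rewrite ang_half => E; have hx' : orient s (h x') = (if t then 1 else 0).
    by have := congr1 fst E; case: t E => E /=; rewrite /ang /=; lra.
  have [|t' [x'E oE lE]] := @end_half s x'.
    by move: hx'; case: s t {E} => [] [] /=; lra.
  rewrite hx' in oE; rewrite x'E.
  rewrite -[endw true false](_ : endw (col (if t then b4 else b1)) false = _); last by case: (t).
  apply: (pq_mates _ _ _ _ _ lE) => //.
  by move: oE lE; case: t {E hx' x'E} => oE [] lE; rewrite lE in oE *; move: oE => /= oE //;
    exfalso; lra.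
case: cx cy xy => [[s ->]|[s [x' [-> rx]]]] [[t ->]|[t [y' [-> ry]]]] xy.
- case: s t xy => [] [] /=; try (by move=> _; exact: glue_refl);
    by rewrite /ang /= => -[E]; exfalso; lra.
- by apply: glue_sym; apply: main_half.
- exact: main_half.
- move: xy; rewrite !ang_half => /(arc_inj (orient_itv s (h_itv x'))).
  have [<-{t} [oxy _]|st [oxy s01]] := pselect (s = t).
    apply: glue_consw; apply: h_rim_inj => //.
    by case: s oxy => //= oxy; lra.
  have /andP[x0 x1] := h_itv x'; have /andP[y0 y1] := h_itv y'.
  have {s01} o01 : orient s (h x') = 0 \/ orient s (h x') = 1 by case: s01; auto.
  have [|a [x'E ox lx]] := @end_half s x'.
    by case: s {st oxy} o01 => /= -[]; [left|right|right|left]; lra.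
  have [|b [y'E oy ly]] := @end_half t y'.
    by rewrite oxy in o01; case: t {st oxy} o01 => /= -[]; [left|right|right|left]; lra.
  rewrite x'E y'E; apply: (pq_mates _ _ _ _ _ lx) => //.
  rewrite ox oy in oxy; case: lx ly oxy => -> [] -> //= oxy; exfalso; lra.
Qed.

(** ** Sites *)

Definition dyadic (u : seq bool) : R := foldr (fun s t => digit (bit s) t) (1 / 2) u.

Lemma h_dyadic (u : seq bool) w : h (catw (rcons (map bit u) r3) w) = dyadic u.
Proof. by elim: u => [|s u IH] /=; rewrite h_consw // IH. Qed.

Lemma dyadic_itv (u : seq bool) : 0 < dyadic u < 1.
Proof.
elim: u => [|s u /andP[d0 d1]] /=; first by apply/andP; split; lra.
by case: s => /=; apply/andP; split; lra.
Qed.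

Lemma dyadic_inj : injective dyadic.
Proof.
elim=> [|s u IH] [|s' u'] //=.
- by have /andP[d0 d1] := dyadic_itv u'; case: s' => /= E; exfalso; lra.
- by have /andP[d0 d1] := dyadic_itv u; case: s => /= E; exfalso; lra.
have /andP[d0 d1] := dyadic_itv u'; have /andP[e0 e1] := dyadic_itv u.
by case: s s' => [] [] /= E; try (congr cons; apply: IH; lra); exfalso; lra.
Qed.

Lemma ang_wd d w : ang (catw (wd d) w) =
  match d with
  | inl s => ((if s then 1 else -1), 0)
  | inr (s, u) => arc s (orient s (dyadic u))
  end.
Proof. by case: d => [[]|[s u]] //=; rewrite ang_half h_dyadic. Qed.

Lemma ang_wd_inj d e w w' : ang (catw (wd d) w) = ang (catw (wd e) w') -> d = e.
Proof.
have end_arc (s s' : bool) (u : seq bool) :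
    ((if s then 1 else -1), 0) <> arc s' (orient s' (dyadic u)).
  have /andP[d0 d1] := dyadic_itv u.
  by rewrite /arc => -[E _]; case: s s' E => [] [] /= E; lra.
rewrite !ang_wd; case: d e => [s|[s u]] [s'|[s' u']].
- by case: s s' => [] [] // -[E]; exfalso; lra.
- by move=> /end_arc.
- by move=> /esym/end_arc.
have /andP[d0 d1] := dyadic_itv u; have /andP[e0 e1] := dyadic_itv u'.
have od : 0 < orient s (dyadic u) < 1 by case: (s) => /=; apply/andP; split; lra.
have /andP[od0 od1] := od.
move=> /arc_inj[|oo [ss|o0|o1]]; try (by exfalso; lra).
  by rewrite !ltW.
by congr (inr (_, _)) => //; apply: dyadic_inj; move: oo; rewrite -ss; case: (s) => /= ?; lra.
Qed.

(** ** Angles separate words up to gluing *)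

Local Notation unws := (unwings_of unw).

Definition same_angles x y := forall s : seq wsite, ang (unws s x) = ang (unws s y).

Lemma same_angles_wd d x y :
  same_angles (catw (wd d) x) (catw (wd d) y) -> same_angles x y.
Proof. by move=> xy s; have := xy (d :: s); rewrite /= !unw_wd. Qed.

Lemma endw_wd s : endw true s = catw (wd (inl s)) (endw true true).
Proof. by case: s => /=; apply: boolp.funext => -[|[|n]]. Qed.

Lemma tip_step s x : valid true x -> same_angles x (endw true s) ->
  exists2 x', x = catw (wd (inl s)) x' &
    valid true x' /\ same_angles x' (endw true true).
Proof.
move=> vx xs; have [[d /on_wingE xE]|[t [f xE]]] := blue_wordP vx; last first.
  have : ang (unw (inl s) x) = ang (unw (inl s) (endw true s)) := xs [:: inl s].
  rewrite xE unw_rim (endw_wd s) unw_wd (endw_wd false).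
  by rewrite (endw_wd true) => /ang_wd_inj.
have dE : d = inl s.
  apply: (@ang_wd_inj _ _ (unw d x) (endw true true)); rewrite -xE -endw_wd.
  exact: (xs [::]).
subst d; exists (unw (inl s) x) => //; split; first exact: unw_valid.
by apply: (@same_angles_wd (inl s)); rewrite -endw_wd -xE.
Qed.

(** An end of the space is represented by a single word, which the angles read
    letter by letter. *)
Lemma tip_rigid s x : valid true x -> same_angles x (endw true s) -> x = endw true s.
Proof.
move=> vx xs; apply: boolp.funext => n.
elim: n s x vx xs => [|n IH] s x vx xs; have [x' -> [vx' xs']] := tip_step vx xs;
  rewrite endw_wd //.
exact: (IH true).
Qed.

(** Both words are followed through the wings that they enter. As long as they
    enter the same wings they agree on longer and longer prefixes; otherwise one
    of them stays on the circle, and the other one then runs to the bottom of a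
    wing attached at the same point. *)
Lemma angles_separate_words x y : valid true x -> valid true y -> same_angles x y -> glue x y.
Proof.
move=> vx vy xy; suff : forall n, mkseq x n = mkseq y n \/ glue x y.
  move=> E; have [//|nxy] := pselect (glue x y); left.
  apply: boolp.funext => n; have [|//] := E n.+1.
  by move=> /mkseq_eqP; apply.
move=> n; have [m] := ubnP n; elim: m n x y vx vy xy => // m IH [|n] x y vx vy xy nm.
  by left.
have rim_word s f : circ_word (consw (half s) (bit \o f)) by left; exists s, f.
have site_word d : circ_word (catw (wd d) (endw true false)) by right; exists d.
have wing_rim d z s f : valid true z ->
    same_angles (catw (wd d) z) (consw (half s) (bit \o f)) ->
    glue (catw (wd d) z) (consw (half s) (bit \o f)).
  move=> vz zf; have zE : z = endw true false.
    apply: tip_rigid => // t; have := zf (d :: t).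
    by rewrite /= unw_wd unw_rim.
  rewrite zE; apply: circ_inj => //.
  by rewrite -zE; exact: (zf [::]).
have [[d /on_wingE xE]|[s [f xE]]] := blue_wordP vx;
have [[e /on_wingE yE]|[t [g yE]]] := blue_wordP vy.
- have de : d = e.
    by apply: (@ang_wd_inj _ _ (unw d x) (unw e y)); rewrite -xE -yE; exact: (xy [::]).
  subst e; rewrite xE yE in xy *.
  have [||||xy'|gxy] := IH (n.+1 - size (wd d))%N (unw d x) (unw d y).
  + exact: unw_valid.
  + exact: unw_valid.
  + exact: same_angles_wd xy.
  + have : (0 < size (wd d))%N by case: (d) => [|[]].
    by lia.
  + left; apply: (@mkseq_eq_le _ _ _ (size (wd d) + (n.+1 - size (wd d)))); first by lia.
    by rewrite !mkseq_catw xy'.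
  + by right; exact: glue_catw.
- by right; rewrite xE yE in xy *; apply: wing_rim => //; exact: unw_valid.
- right; apply: glue_sym; rewrite xE yE in xy *; apply: wing_rim; first exact: unw_valid.
  by move=> r; rewrite xy.
- by right; rewrite xE yE in xy *; apply: circ_inj => //; exact: (xy [::]).
Qed.
End Angles.

Local Close Scope ring_scope.

(** * The limit space as a space of streams *)

Section LimitSpace.

Local Notation AS := airplane_system.
Local Notation T := airplane_limit_space.
Implicit Types (u v : seq lett) (w : stream) (a b : lett) (c : bool).

Section Cylinders.
Context (S : replacement_system).
Implicit Types (x y : iword S).

Definition cylinder x n : set (iword S) := [set y | forall i, (i < n)%N -> y i = x i].

Lemma cylinder_nbhs x n : nbhs x (cylinder x n).
Proof.
elim: n => [|n IH]; first by apply: filterS (filterT) => y _ i.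
have nx : nbhs x [set y | y n = x n].
  have : nbhs (x n : discrete_topology (letter S)) [set x n].
    by rewrite nbhs_principalE; exact/principal_filterP.
  by move=> /(@proj_continuous _ (fun=> discrete_topology (letter S)) n x).
apply: filterS2 IH nx => y xy yn i; rewrite ltnS leq_eqVlt => /orP[/eqP->//|].
exact: xy.
Qed.

(** The filter generated by the cylinders converges coordinatewise, hence in the
    product topology. *)
Lemma nbhs_cylinder x (A : set (iword S)) : nbhs x A -> exists n, cylinder x n `<=` A.
Proof.
pose F := filter_from [set: nat] (cylinder x).
have FF : Filter F.
  apply: filter_from_filter; first by exists 0%N.
  move=> m n _ _; exists (maxn m n) => // y xy.
  by split=> i ni; apply: xy; rewrite leq_max ni ?orbT.
suff : F --> x by move=> /[apply] -[n _ nA]; exists n.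
apply/cvg_sup => i B [C [[D oD <-] Dx DB]].
exists i.+1 => // y xy; apply: DB => /=; rewrite /proj xy //.
Qed.
End Cylinders.

Lemma symbol_nbhs (x : symbol_space AS) (P : set (symbol_space AS)) : nbhs x P <->
  exists n, forall y, (forall i, (i < n)%N -> set_val y i = set_val x i) -> P y.
Proof.
split=> [[_ [[B oB <-] /= Bx BP]]|[n nP]].
  have [n nB] := nbhs_cylinder (open_nbhs_nbhs (conj oB Bx)).
  by exists n => y xy; apply: BP; apply: nB.
have := @set_val_continuous _ (symbol_space AS) x _ (@cylinder_nbhs AS (set_val x) n).
by apply: (@filterS _ (nbhs x)) => y; exact: nP.
Qed.

Lemma compact_symbol_space : compact [set: symbol_space AS].
Proof.
apply: compact_set_type.
have cl : closed (symbol_space AS : set (iword AS)).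
  rewrite -[X in closed X]setCK; apply: open_closedC; rewrite openE => x /= nx.
  have [k nk] : exists k, ~ ((0 < k)%N -> exists2 G : named_graph AS, graph_expansion G &
       exists e : edge G, name e = prefix_word x k) by apply/boolp.existsNP.
  apply: filterS (cylinder_nbhs x k) => y xy sy; apply: nk => k0.
  have [G GE [e eE]] := sy k k0; exists G => //; exists e; rewrite eE /prefix_word /mkseq.
  by apply/eq_in_map => i; rewrite mem_iota => ik; exact: xy.
apply: (subclosed_compact cl) (@subsetT _ _).
have := @tychonoff nat (fun=> discrete_topology (letter AS)) (fun=> setT).
rewrite (_ : [set f | _] = setT); first by apply=> i; apply: finite_compact; exact: (@finite_finset (letter AS)).
by apply/seteqP; split.
Qed.

(** Invalid streams are sent to an arbitrary point. *)
Definition symbol_of w : symbol_space AS :=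
  match pselect (valid true w) with
  | left v => sub_point (word_of_symbol v)
  | right _ => sub_point (word_of_symbol (endw_valid true true))
  end.

Lemma symbol_ofE w : valid true w -> set_val (symbol_of w) = word_of w.
Proof. by rewrite /symbol_of; case: pselect. Qed.

Lemma symbol_of_onto (x : symbol_space AS) : exists2 w, valid true w & symbol_of w = x.
Proof.
have [w vw xE] := symbol_word (sub_pointP x).
by exists w => //; apply: val_inj; rewrite -[LHS]/(set_val _) symbol_ofE.
Qed.

Local Notation Q := ({eq_quot (gluing_equiv airplane_gluing)})%qT.

Definition pi w : T := (\pi_Q (symbol_of w))%qT.

Lemma pi_onto (t : T) : exists2 w, valid true w & pi w = t.
Proof.
have [w vw wE] := symbol_of_onto (repr (t : Q)).
by exists w => //; rewrite /pi wE reprK.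
Qed.

Lemma piP w w' : valid true w -> valid true w' -> pi w = pi w' <-> glue w w'.
Proof.
move=> vw vw'; have gl : pi w = pi w' <-> gluing (symbol_of w) (symbol_of w').
  split=> [/eqmodP /asboolP //|g].
  by apply/eqmodP; apply/asboolP.
rewrite gl; split=> [g|[->|]].
- have [->|ww'] := pselect (w = w'); first exact: glue_refl.
  by right; apply: gluing_mates g => //; exact: symbol_ofE.
- by have [? _ _] := airplane_gluing.
- by apply: mates_gluing; exact: symbol_ofE.
Qed.

Lemma word_of_eq w w' n : (forall i, (i < n.+1)%N -> word_of w i = word_of w' i) <->
  mkseq w n = mkseq w' n.
Proof.
rewrite -mkseq_eqP; split=> [ww' i ni|ww' [|i] //= ni]; last by rewrite ww'.
by have := ww' i.+1 ni; rewrite /=; exact: (can_inj encK).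
Qed.

Lemma continuous_on_streams (Z : topologicalType) (f : T -> Z) :
  (forall w, valid true w -> forall U, nbhs (f (pi w)) U ->
    exists n, forall w', valid true w' -> mkseq w n = mkseq w' n -> U (f (pi w'))) ->
  continuous f.
Proof.
move=> fc; apply/quotient_continuous => x U fU.
have [w vw xE] := symbol_of_onto x; subst x.
have [n nU] := fc w vw U fU; apply/symbol_nbhs; exists n.+1 => y yw.
have [w' vw' yE] := symbol_of_onto y; subst y; apply: nU => //.
apply/esym/word_of_eq => i ni; move: (yw i ni).
by rewrite (symbol_ofE vw) (symbol_ofE vw').
Qed.

Lemma nbhs_streams w (U : set T) : valid true w -> nbhs (pi w) U ->
  exists n, forall w', valid true w' -> mkseq w n = mkseq w' n -> U (pi w').
Proof.
move=> vw Uw; have := @pi_continuous _ Q (symbol_of w) U Uw.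
move=> /symbol_nbhs[n nU]; exists n => w' vw' /mkseq_eq_le ww'.
apply: nU => i ni; rewrite !symbol_ofE //.
have [j ij] : exists j, n = j.+1 by exists n.-1; rewrite prednK // (leq_ltn_trans _ ni).
subst n; apply/esym; apply: (iffRL (word_of_eq w w' j)) i ni; exact: ww'.
Qed.

Lemma compactT : compact [set: T].
Proof.
have -> : [set: T] = (\pi_Q : symbol_space AS -> T)%qT @` [set: symbol_space AS].
  by apply/seteqP; split=> // t _; exists (repr (t : Q)) => //; exact: reprK.
apply: continuous_image_compact compact_symbol_space.
exact: pi_continuous.
Qed.

(** ** The limit space is a winged circle *)

Definition rep (t : T) : stream := projT1 (cid2 (pi_onto t)).

Lemma rep_valid t : valid true (rep t).
Proof. by rewrite /rep; case: cid2. Qed.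

Lemma repK t : pi (rep t) = t.
Proof. by rewrite /rep; case: cid2. Qed.

Lemma rep_pi w : valid true w -> glue (rep (pi w)) w.
Proof. by move=> vw; apply/piP => //; [exact: rep_valid|exact: repK]. Qed.

Lemma pi_glue w w' : valid true w -> valid true w' -> glue w w' -> pi w = pi w'.
Proof. by move=> vw vw' /piP; apply. Qed.

Definition pi_wing d (t : T) : T := pi (catw (wd d) (rep t)).
Definition pi_unwing d (t : T) : T := pi (unw d (rep t)).

Lemma pi_wingE d w : valid true w -> pi_wing d (pi w) = pi (catw (wd d) w).
Proof.
move=> vw; apply: pi_glue; first by apply/valid_wd; exact: rep_valid.
  exact/valid_wd.
by apply: glue_catw; exact: rep_pi.
Qed.

Lemma pi_unwingE d w : valid true w -> pi_unwing d (pi w) = pi (unw d w).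
Proof.
move=> vw; apply: pi_glue; first by apply: unw_valid; exact: rep_valid.
  exact: unw_valid.
by apply: unw_glue; exact: rep_pi.
Qed.

Lemma pi_unwingsE s w : valid true w ->
  unwings_of pi_unwing s (pi w) = pi (unwings_of unw s w).
Proof.
by elim: s w => //= d s IH w vw; rewrite pi_unwingE // IH //; exact: unw_valid.
Qed.

Lemma unws_valid (s : seq wsite) w : valid true w -> valid true (unwings_of unw s w).
Proof. by elim: s w => //= d s IH w vw; apply: IH; exact: unw_valid. Qed.

Definition wings_word (s : seq wsite) w := wings_of (fun d => catw (wd d)) s w.

Lemma wings_word_valid s w : valid true w -> valid true (wings_word s w).
Proof. by move=> vw; elim: s => //= d s IH; apply/valid_wd. Qed.

Lemma pi_wingsE s w : valid true w ->
  wings_of pi_wing s (pi w) = pi (wings_word s w).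
Proof.
move=> vw; elim: s => //= d s ->; rewrite pi_wingE //; exact: wings_word_valid.
Qed.

(** A word either enters a wing, and the rest of it is approximated first, or stays
    on a half circle, where it is approximated by dyadic points. *)
Lemma site_words_dense n w : valid true w ->
  exists s d, mkseq w n = mkseq (wings_word s (catw (wd d) (endw true false))) n.
Proof.
have [m] := ubnP n; elim: m n w => // m IH [|n] w nm vw.
  by exists [::], (inl false).
have [[d /on_wingE wE]|[s [f wE]]] := blue_wordP vw.
  have [||s [e wse]] := IH (n.+1 - size (wd d))%N (unw d w).
  - have : (0 < size (wd d))%N by case: (d) => [|[]].
    by lia.
  - exact: unw_valid.
  exists (d :: s), e; rewrite wE /=.
  apply: (@mkseq_eq_le _ _ _ (size (wd d) + (n.+1 - size (wd d)))); first by lia.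
  by rewrite !mkseq_catw wse.
exists [::], (inr (s, mkseq f n)); rewrite wE.
have -> : wings_word [::] (catw (wd (inr (s, mkseq f n))) (endw true false)) =
  consw (half s) (catw (rcons (map bit (mkseq f n)) r3) (endw true false)) by [].
rewrite !mkseqSl; congr cons.
rewrite -[RHS]/(mkseq (catw (rcons (map bit (mkseq f n)) r3) _) n) catw_take.
  by rewrite -cats1 take_size_cat ?size_map ?size_map ?size_iota // /mkseq -map_comp.
by rewrite size_rcons size_map size_mkseq.
Qed.

Section Winged.
Context (R : realType).

Definition pi_angle (t : T) : R * R := ang R (rep t).

Lemma pi_angleE w : valid true w -> pi_angle (pi w) = ang R w.
Proof.
by move=> vw; apply: ang_glue => //; [exact: rep_valid|exact: rep_pi].
Qed.

Lemma pi_angle_continuous : continuous pi_angle.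
Proof.
apply: continuous_on_streams => w vw U; rewrite pi_angleE // => /ang_continuous[n nU].
by exists n => w' vw' ww'; rewrite pi_angleE //; exact: nU.
Qed.

Lemma pi_wing_continuous d : continuous (pi_wing d).
Proof.
apply: continuous_on_streams => w vw U; rewrite pi_wingE //.
move=> /nbhs_streams[|n nU]; first exact/valid_wd.
exists n => w' vw' ww'; rewrite pi_wingE //; apply: nU; first exact/valid_wd.
apply: (@mkseq_eq_le _ _ _ (size (wd d) + n)); first exact: leq_addl.
by rewrite !mkseq_catw ww'.
Qed.

Lemma pi_unwing_continuous d : continuous (pi_unwing d).
Proof.
apply: continuous_on_streams => w vw U; rewrite pi_unwingE //.
move=> /nbhs_streams[|n nU]; first exact: unw_valid.
exists (size (wd d) + n)%N => w' vw' ww'; rewrite pi_unwingE //.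
apply: nU; first exact: unw_valid.
have sd : mkseq w (size (wd d)) = mkseq w' (size (wd d)).
  exact: mkseq_eq_le (leq_addr _ _) ww'.
have [dw|ndw] := pselect (on_wing d w); last first.
  by rewrite !unw_out // /on_wing -sd.
have dw' : on_wing d w' by rewrite /on_wing -sd.
move: ww'; rewrite {1}(on_wingE dw) {1}(on_wingE dw') !mkseq_catw.
by move=> /(congr1 (drop (size (wd d)))); rewrite !drop_size_cat.
Qed.

Lemma pi_sites_dense (O : set T) : open O -> O !=set0 ->
  exists s d, O (wings_of pi_wing s (pi_wing d (pi (endw true false)))).
Proof.
move=> oO [t]; have [w vw <-] := pi_onto t => Ow.
have [n nO] := nbhs_streams vw (open_nbhs_nbhs (conj oO Ow)).
have [s [d wsd]] := site_words_dense n vw; exists s, d.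
have v0 : valid true (endw true false) by exact: endw_valid.
have vd : valid true (catw (wd d) (endw true false)) by exact/valid_wd.
by rewrite pi_wingE // pi_wingsE //; apply: nO => //; exact: wings_word_valid.
Qed.

Let bot := pi (endw true false).

Let v0 : valid true (endw true false) := endw_valid true false.
Let v1 : valid true (endw true true) := endw_valid true true.

Lemma pi_wingK d : cancel (pi_wing d) (pi_unwing d).
Proof.
move=> t; have vt := rep_valid t.
by rewrite -(repK t) pi_wingE // pi_unwingE ?unw_wd //; exact/valid_wd.
Qed.

Lemma pi_unwingK d t : pi_unwing d t <> bot -> pi_wing d (pi_unwing d t) = t.
Proof.
rewrite -(repK t); have vt := rep_valid t; rewrite pi_unwingE // => nb.
have [dw|/unw_out E] := pselect (on_wing d (rep t)); last by rewrite E in nb.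
by rewrite pi_wingE -?on_wingE //; exact: unw_valid.
Qed.

Lemma pi_angle_wing d t : pi_angle (pi_wing d t) = pi_angle (pi_wing d bot).
Proof.
have vt := rep_valid t.
by rewrite -(repK t) !pi_wingE // !pi_angleE ?ang_wd //; exact/valid_wd.
Qed.

Lemma pi_site_inj d e : pi_angle (pi_wing d bot) = pi_angle (pi_wing e bot) -> d = e.
Proof.
rewrite !pi_wingE // !pi_angleE; [exact: ang_wd_inj|exact/valid_wd..].
Qed.

Lemma pi_wing_top s : pi_wing (inl s) (pi (endw true true)) = pi (endw true s).
Proof. by rewrite pi_wingE // -endw_wd. Qed.

Lemma pi_angle_onto z : unit_circle R z ->
  exists2 t, pi_angle t = z & forall d, pi_unwing d t = bot.
Proof.
move=> /ang_onto[s [f sf]]; have vr := rim_word_valid s f.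
exists (pi (consw (half s) (bit \o f))); first by rewrite pi_angleE.
by move=> d; rewrite pi_unwingE // unw_rim.
Qed.

Lemma pi_angle_separates t t' :
  (forall s, pi_angle (unwings_of pi_unwing s t) = pi_angle (unwings_of pi_unwing s t')) ->
  t = t'.
Proof.
have vt := rep_valid t; have vt' := rep_valid t'; rewrite -(repK t) -(repK t') => tt'.
apply: pi_glue => //; apply: (@angles_separate_words R) => // s.
by have := tt' s; rewrite !pi_unwingsE // !pi_angleE //; exact: unws_valid.
Qed.

Definition airplane_wings : winged_circle R T :=
  @WingedCircle R T wsite (inl false) (inl true) (pi (endw true false))
    (pi (endw true true)) pi_angle pi_wing pi_unwing
    pi_angle_continuous pi_wing_continuous pi_unwing_continuous
    (fun t => ang_circle R (rep t)) pi_wingK pi_unwingK pi_angle_wing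
    pi_site_inj (fun E => ltac:(discriminate E)) (pi_wing_top false)
    (pi_wing_top true) pi_angle_onto pi_angle_separates pi_sites_dense.
End Winged.

(** ** Cells *)

Definition cell u : set T := [set pi (catw u w) | w in [set w | valid true (catw u w)]].

Lemma cell_rcons u t : cell u t -> exists a, cell (rcons u a) t.
Proof.
move=> [w vw <-]; exists (w 0%N).
by exists (tailw w); rewrite /= catw_rcons -stream_eta.
Qed.

Lemma cell_sub u v : cell (u ++ v) `<=` cell u.
Proof. by move=> _ [w vw <-]; exists (catw v w); rewrite /= -catw_cat. Qed.

Lemma cell_ok u : cell u !=set0 -> okpath true u.
Proof. by move=> [_ [w /valid_cat[ok _] _]]. Qed.

Lemma cell_meet u a s b s' : okpath true u -> dom a = endcol true u ->
  dom b = endcol true u -> lab a s = lab b s' -> inner_lab (lab a s) ->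
  cell (rcons u a) `&` cell (rcons u b) !=set0.
Proof.
move=> ok da db ab ia.
have va e t : dom e = endcol true u -> valid true (catw u (consw e (endw (col e) t))).
  by move=> de; apply/valid_cat; split=> //; apply/valid_cons; split=> //; exact: endw_valid.
exists (pi (catw u (consw a (endw (col a) s)))); split.
  by exists (endw (col a) s); rewrite /= catw_rcons //; exact: va.
exists (endw (col b) s'); rewrite /= catw_rcons; first exact: va.
apply: pi_glue; [exact: va..|].
by right; exists u, b, s', a, s; rewrite -ab.
Qed.

Lemma okpath_valid w c : (forall n, okpath c (mkseq w n)) -> valid c w.
Proof.
move=> ok; split; first by have := ok 1; rewrite mkseqSl /= andbT => /eqP.
move=> n; elim: n w c ok => [|n IH] w c ok.
  by have := ok 2; rewrite !mkseqSl /= andbT => /andP[_ /eqP].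
by apply: (IH (tailw w) (col (w 0))) => k; have := ok k.+1; rewrite mkseqSl => /andP[].
Qed.

(** A cell is made of cells that form a connected graph: if a clopen set split a
    cell it would split one of these, and inductively all the cells around a
    point, against openness. *)
Lemma cell_connected u : connected (cell u).
Proof.
move=> B [t0 Bt0] [ O oO BO] [F cF BF].
have OF t : cell u t -> O t <-> F t.
  move=> ut; have E : cell u `&` O = cell u `&` F by rewrite -BO.
  split=> [Ot|Ft].
    by have [] : (cell u `&` F) t by rewrite -E.
  by have [] : (cell u `&` O) t by rewrite E.
pose mono v := cell v `<=` O \/ cell v `<=` ~` F.
have [[uO|uF]|nmono] := pselect (mono u).
- by rewrite BO; apply/seteqP; split=> [t []//|t ut]; split=> //; exact: uO.
- by exfalso; move: Bt0; rewrite BF => -[ut0 Ft0]; exact: uF ut0 Ft0.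
exfalso.
have step v : ~ mono (u ++ v) -> exists a, ~ mono (rcons (u ++ v) a).
  move=> nv; apply: contrapT => /forallNP nn.
  have child a : mono (rcons (u ++ v) a) by apply: contrapT; exact: nn.
  apply: nv; have [[t uvt]|] := pselect (cell (u ++ v) !=set0); last first.
    by move=> e; left => t ut; case: e; exists t.
  have ok : okpath true (u ++ v) by apply: cell_ok; exists t.
  have sub a : cell (rcons (u ++ v) a) `<=` cell u.
    by rewrite -cats1 -catA; exact: cell_sub.
  have link a s b s' : dom a = endcol true (u ++ v) -> dom b = endcol true (u ++ v) ->
      lab a s = lab b s' -> inner_lab (lab a s) ->
      (cell (rcons (u ++ v) a) `<=` O -> cell (rcons (u ++ v) b) `<=` O) /\
      (cell (rcons (u ++ v) a) `<=` ~` F -> cell (rcons (u ++ v) b) `<=` ~` F).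
    move=> da db ab ia; have [z [za zb]] := cell_meet ok da db ab ia.
    have OFz := OF z (sub a _ za).
    split=> H; case: (child b) => // H'.
      by case: (H' _ zb); apply/OFz; exact: H.
    by case: (H _ za); apply/OFz; exact: H'.
  have all_children (X : set T) : (forall a, dom a = endcol true (u ++ v) ->
      cell (rcons (u ++ v) a) `<=` X) -> cell (u ++ v) `<=` X.
    move=> H y /cell_rcons[a ya]; apply: (H a _ _ ya).
    have : okpath true (rcons (u ++ v) a) by apply: cell_ok; exists y.
    elim: (u ++ v) (true) {ok sub link H} => [|e l IHl] c /=; first by rewrite andbT => /eqP.
    by move=> /andP[_ /IHl].
  case ec : (endcol true (u ++ v)) link all_children => link all_children.
    have [l12O l12F] := link b1 false b2 true erefl erefl erefl erefl.
    have [l13O l13F] := link b1 false b3 false erefl erefl erefl erefl.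
    have [l24O l24F] := link b2 false b4 false erefl erefl erefl erefl.
    by case: (child b1) => H; [left|right]; apply: all_children => -[] //= _; auto.
  have [l12O l12F] := link r1 true r2 false erefl erefl erefl erefl.
  have [l13O l13F] := link r1 true r3 false erefl erefl erefl erefl.
  by case: (child r1) => H; [left|right]; apply: all_children => -[] //= _; auto.
pose nx v := if pselect (~ mono (u ++ v)) is left nv then projT1 (cid (step v nv)) else b1.
have nxP v : ~ mono (u ++ v) -> ~ mono (rcons (u ++ v) (nx v)).
  by rewrite /nx; case: pselect => // nv _; exact: (projT2 (cid (step v nv))).
pose vs := fix vs n := if n is n'.+1 then rcons (vs n') (nx (vs n')) else [::].
have nvs n : ~ mono (u ++ vs n).
  by elim: n => [|n IH] /=; rewrite ?cats0 // -rcons_cat; exact: nxP.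
pose f : stream := fun n => nx (vs n).
have vsE n : vs n = mkseq f n by elim: n => [//|n IH]; rewrite mkseqS /= -IH.
pose w := catw u f.
have wE n : mkseq w (size u + n) = u ++ vs n by rewrite mkseq_catw vsE.
have ne n : cell (u ++ vs n) !=set0.
  apply: contrapT => e; apply: (nvs n); left => t ut; case: e; by exists t.
have vw : valid true w.
  apply: okpath_valid => n; have := cell_ok (ne n); rewrite -wE addnC.
  elim: n (w) (true) => [//|n IHn] w' c; rewrite addSn !mkseqSl /=.
  by move=> /andP[-> /IHn].
have uw : cell u (pi w) by exists f.
have near_w (X : set T) : open X -> X (pi w) -> exists n, cell (u ++ vs n) `<=` X.
  move=> oX Xw; have [n nX] := nbhs_streams vw (open_nbhs_nbhs (conj oX Xw)).
  exists n => _ [w' vw' <-]; apply: nX => //.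
  apply: (@mkseq_eq_le _ _ _ (size u + n)); first exact: leq_addl.
  rewrite wE; have {1}<- : size (u ++ vs n) = (size u + n)%N.
    by rewrite -wE size_mkseq.
  by rewrite catw_prefix.
have [Ow|nOw] := pselect (O (pi w)).
  by have [n nO] := near_w O oO Ow; apply: (nvs n); left.
have [n nF] : exists n, cell (u ++ vs n) `<=` ~` F.
  by apply: near_w => [|/(OF _ uw)//]; exact: closed_openC.
by apply: (nvs n); right.
Qed.

Lemma connectedT : connected [set: T].
Proof.
have -> : [set: T] = cell [::]; last exact: cell_connected.
by apply/seteqP; split=> // t _; exists (rep t); [exact: rep_valid|exact: repK].
Qed.

(** ** Local connectedness *)

Section LocallyConnected.
Context (R : realType).

Let hausdorffT : hausdorff_space T := winged_hausdorff (airplane_wings R).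

Let proj (x : symbol_space AS) : T := (\pi_({eq_quot (gluing_equiv airplane_gluing)}) x)%qT.

Let proj_continuous : continuous proj.
Proof. exact: pi_continuous. Qed.

Let same_prefix (x y : symbol_space AS) n :=
  forall i, (i < n)%N -> set_val y i = set_val x i.

Let closed_proj (D : set (symbol_space AS)) n :
  (forall x y, same_prefix x y n -> D y -> D x) -> closed (proj @` D).
Proof.
move=> Dn; apply: compact_closed => //; apply: continuous_image_compact.
  exact: proj_continuous.
apply: subclosed_compact compact_symbol_space (@subsetT _ _).
rewrite -[D]setCK; apply: open_closedC; rewrite openE => x Dx.
by apply/symbol_nbhs; exists n => y xy /(Dn _ _ xy).
Qed.

(** The words of a point form a compact set, so that cells of a common depth
    around all of them are small. *)
Let small_cylinders (t : T) (U : set T) : nbhs t U ->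
  exists n, forall x, proj x = t -> forall y, same_prefix x y n -> U (proj y).
Proof.
move=> tU; have ct : closed [set t].
  by apply: accessible_closed_set1; exact: hausdorff_accessible.
have cK : compact (proj @^-1` [set t]).
  apply: subclosed_compact compact_symbol_space (@subsetT _ _).
  by apply: preimage_closed => // x _; exact: proj_continuous.
have := cK; move=> /compact_near_coveringP /(_ nat \oo
  (fun n x => forall y, same_prefix x y n -> U (proj y)) _) /=.
case=> [x xt|n _ nU]; last by exists n => x xt; exact: (nU n (leqnn n) x xt).
have xU : nbhs x (proj @^-1` U) by apply: proj_continuous; rewrite xt.
have [n nU] := (symbol_nbhs _ _).1 xU.
exists ([set x' | same_prefix x x' n], [set m | (n <= m)%N]).
  by split; [apply/symbol_nbhs; exists n|exists n].
move=> [x' m] /= [xx' nm] y x'y; apply: nU => i ni.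
by rewrite x'y ?xx' // (leq_trans ni).
Qed.

(** The cells of a common large depth around all the words of a point form a small
    connected set. It is a neighborhood, since the words that avoid these cells
    form a compact set. *)
Lemma airplane_locally_connected : locally_connected T.
Proof.
apply: weakly_locally_connected => t U tU.
have [n nU] := small_cylinders tU.
pose N := \bigcup_(w in [set w | valid true w /\ pi w = t]) cell (mkseq w n).
have same w w' : valid true w -> valid true w' -> mkseq w n = mkseq w' n <->
    same_prefix (symbol_of w) (symbol_of w') n.+1.
  move=> vw vw'; rewrite -word_of_eq /same_prefix !symbol_ofE //.
  by split=> H i ni; rewrite H.
have self w : valid true w -> cell (mkseq w n) (pi w).
  by move=> vw; exists (dropw n w); rewrite /= catw_mkseq.
exists N; split.
- pose D := [set y | forall w, valid true w -> pi w = t ->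
    ~ same_prefix (symbol_of w) y n.+1].
  have cD : closed (proj @` D).
    apply: (@closed_proj _ n.+1) => x y xy Dy w vw wt wx; apply: (Dy w vw wt).
    by move=> i ni; rewrite xy // wx.
  have : nbhs t (~` (proj @` D)).
    apply: open_nbhs_nbhs; split; first exact: closed_openC.
    move=> [y Dy yt]; have [w vw wy] := symbol_of_onto y.
    by apply: (Dy w vw); [rewrite /pi wy|rewrite wy].
  apply: filterS => s sD; have [w vw ws] := pi_onto s.
  have [w' [vw' w't ww']] : exists w', [/\ valid true w', pi w' = t &
      same_prefix (symbol_of w') (symbol_of w) n.+1].
    apply: contrapT => nw; apply: sD; exists (symbol_of w) => // w' vw' w't ww'.
    by apply: nw; exists w'.
  exists w' => //; have /same E := ww'; rewrite E // -ws; exact: self.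
- apply: bigcup_connected => [|w _]; last exact: cell_connected.
  by exists t => w [vw wt]; rewrite -wt; exact: self.
- move=> _ [w [vw wt] [w' vw' <-]]; apply: (nU (symbol_of w)) => //.
  move=> i ni; apply: ((same _ _ vw vw').1) (ltnW ni).
  by have := catw_prefix (mkseq w n) w'; rewrite size_mkseq => ->.
Qed.
End LocallyConnected.

End LimitSpace.

Theorem propositionC11 (R : realType) : airplane R airplane_limit_space.
Proof.
apply: (@winged_circle_airplane R _ (airplane_wings R)).
- exact: compactT.
- exact: connectedT.
- exact: (airplane_locally_connected R).
Qed.
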